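(* Let $n\ge2$, $1<\mu\le2$, and $G_\mu:=\{z\in\mathbb{D}^n:\operatorname{Re}z_1<\sum_{j=2}^n|z_j|^\mu\}$. For $t\in(0,1)$ let $p_t:=(-t,0)\in\mathbb{C}\times\mathbb{C}^{n-1}$. Then $$S_{G_\mu}(p_\varepsilon;X)\gtrsim\varepsilon^{\frac1\mu-1}|X_1|+\|X\|,$$ i.e. there is a constant $c>0$ such that $S_{G_\mu}(p_\varepsilon;X)\ge c\,(\varepsilon^{\frac1\mu-1}|X_1|+\|X\|)$ for all $\varepsilon\in(0,1)$ and all $X=(X_1,\dots,X_n)\in\mathbb{C}^n$.
   Context: $\mathbb{D}$ is the open unit disc in $\mathbb{C}$ and $\|\cdot\|$ is the Euclidean norm. The Sibony metric of a domain $D\subset\mathbb{C}^n$ at $p\in D$, $X\in\mathbb{C}^n$, is $$S_D(p;X):=\sup\Big\{\Big(\sum_{i,j=1}^n\frac{\partial^2u}{\partial z_i\partial\bar z_j}(p)X_i\bar X_j\Big)^{1/2}:u\in A(p,D)\Big\},$$ where $A(p,D)$ is the set of (plurisubharmonic) functions $u$ on $D$ such that $u(p)=0$, $u$ is $\mathcal{C}^2$ near $p$, $\log u$ is plurisubharmonic on $D$, and $0\le u\le1$ on $D$. *)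

(* Defs.v *)
(* C^n is 'rV[R[i]]_n, the complex numbers being R[i] for an abstract R : realType. *)
From HB Require Import structures.
From mathcomp Require Import all_boot all_order all_algebra complex.
From mathcomp Require Import all_classical all_reals all_analysis.

Set Implicit Arguments.
Unset Strict Implicit.
Unset Printing Implicit Defensive.

Import Order.TTheory GRing.Theory Num.Theory.
Import numFieldNormedType.Exports.

Local Open Scope classical_set_scope.
Local Open Scope complex_scope.
Local Open Scope ring_scope.

(* The topology of the modulus, which the library provides on R[i]^o only. *)
HB.instance Definition _ (R : realType) :=
  PseudoPointedMetric.copy R[i] R[i]^o.
HB.instance Definition _ (R : realType) := NormedModule.copy R[i] R[i]^o.

Section Sibony.
Context {R : realType}.

Definition cmod (z : R[i]) : R := complex.Re `|z|.

Definition enorm n (X : 'rV[R[i]]_n) : R :=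
  Num.sqrt (\sum_(j < n) cmod (X 0 j) ^+ 2).

Definition usc_on (T : topologicalType) (D : set T) (f : T -> \bar R) :=
  forall x, D x -> forall a : R, (f x < a%:E)%E ->
    \forall y \near within D (nbhs x), (f y < a%:E)%E.

Definition circle_mean (v : R[i] -> \bar R) (z : R[i]) (r : R) : \bar R :=
  (((2 * pi)^-1)%:E *
   \int[lebesgue_measure]_(t in `[0%R, (2 * pi)%R])
     v (z + r%:C * (cos t +i* sin t))%R)%E.

(* U is meant to be open: upper semicontinuity and the submean inequality on
   all sufficiently small circles. The constant -oo is allowed. *)
Definition subharmonic (U : set R[i]) (v : R[i] -> \bar R) :=
  [/\ forall z, U z -> (v z < +oo)%E,
      usc_on U v &
      forall z, U z -> exists2 rho : R, 0 < rho &
        forall r : R, 0 < r < rho -> (v z <= circle_mean v z r)%E].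

Definition plurisubharmonic n (D : set 'rV[R[i]]_n)
    (u : 'rV[R[i]]_n -> \bar R) :=
  [/\ forall z, D z -> (u z < +oo)%E,
      usc_on D u &
      forall a b : 'rV[R[i]]_n,
        subharmonic [set l | D (a + l *: b)] (fun l => u (a + l *: b))].

(* The unit vectors of the real coordinates x_j and y_j, where
   z_j = x_j + i y_j. *)
Definition xdir n (j : 'I_n) : 'rV[R[i]]_n := delta_mx 0 j.
Definition ydir n (j : 'I_n) : 'rV[R[i]]_n := (0 +i* 1) *: delta_mx 0 j.

(* C^n is not a normed module over R, so real directional derivatives are
   taken along a real line. *)
Definition rderiv n (v : 'rV[R[i]]_n) (u : 'rV[R[i]]_n -> R) :
    'rV[R[i]]_n -> R :=
  fun z => derive1 (fun t : R => u (z + t%:C *: v)) 0.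

Definition C1_on n (V : set 'rV[R[i]]_n) (u : 'rV[R[i]]_n -> R) :=
  forall (j : 'I_n) v, v = xdir j \/ v = ydir j ->
  forall z, V z ->
    derivable (fun t : R => u (z + t%:C *: v)) 0 1 /\
    {for z, continuous (rderiv v u)}.

Definition C2_on n (V : set 'rV[R[i]]_n) (u : 'rV[R[i]]_n -> R) :=
  C1_on V u /\
  forall (j : 'I_n) v, v = xdir j \/ v = ydir j -> C1_on V (rderiv v u).

Definition C2_near n (p : 'rV[R[i]]_n) (u : 'rV[R[i]]_n -> R) :=
  exists V : set 'rV[R[i]]_n, [/\ open V, V p & C2_on V u].

(* d/dz_i d/dzbar_j u, obtained by expanding
   1/2 (d/dx_i - i d/dy_i) o 1/2 (d/dx_j + i d/dy_j). *)
Definition dz_dzbar n (u : 'rV[R[i]]_n -> R) (i j : 'I_n)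
    (p : 'rV[R[i]]_n) : R[i] :=
  ((rderiv (xdir i) (rderiv (xdir j) u) p
    + rderiv (ydir i) (rderiv (ydir j) u) p) / 4) +i*
  ((rderiv (xdir i) (rderiv (ydir j) u) p
    - rderiv (ydir i) (rderiv (xdir j) u) p) / 4).

(* For u of class C^2 near p the sum is already real. *)
Definition levi n (u : 'rV[R[i]]_n -> R) (p X : 'rV[R[i]]_n) : R :=
  complex.Re (\sum_(i < n) \sum_(j < n)
    dz_dzbar u i j p * X 0 i * (X 0 j)^*%C).

(* lne 0 = -oo, so log u is -oo on the zeros of u. *)
Definition sibony_class n (p : 'rV[R[i]]_n) (D : set 'rV[R[i]]_n) :
    set ('rV[R[i]]_n -> R) :=
  [set u | [/\ plurisubharmonic D (fun z => (u z)%:E),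
               u p = 0,
               C2_near p u,
               plurisubharmonic D (fun z => lne (u z)%:E) &
               forall z, D z -> 0 <= u z <= 1]].

Definition sibony_metric n (D : set 'rV[R[i]]_n) (p X : 'rV[R[i]]_n) :
    \bar R :=
  ereal_sup [set (Num.sqrt (levi u p X))%:E | u in sibony_class p D].

(* In C^(m+1) = C x C^m, ord0 indexes z_1 and lift ord0 j, for j < m, the
   coordinates z_2, ..., z_(m+1). *)
Definition G m (mu : R) : set 'rV[R[i]]_m.+1 :=
  [set z : 'rV[R[i]]_m.+1 |
           (forall j, cmod (z 0 j) < 1) /\
           complex.Re (z 0 ord0) <
             \sum_(j < m) cmod (z 0 (lift ord0 j)) `^ mu].

Definition pt m (t : R) : 'rV[R[i]]_m.+1 :=
  \row_j (if j == ord0 then (- t)%:C else 0).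

End Sibony.

Arguments G {R} m mu _.
Arguments pt {R} m t.

(* Main.v *)
Require Import Defs.
From mathcomp Require Import all_boot all_order all_algebra complex.
From mathcomp Require Import all_classical all_reals all_analysis.
From mathcomp Require Import ring lra.
Import Order.TTheory GRing.Theory Num.Theory.
Import numFieldNormedType.Exports.

(** A single competitor [u] in the class of the Sibony metric at
    [p = (- eps, 0)] gives both terms of the lower bound. Write [z = (z_1, z')].

    Near [p], up to a normalising constant, [u] is
      [inner z = |z'|^2 + kappa * |(z_1 + eps) / (z_1 - 2 * eps)|^2]
    with [kappa] of size [eps ^ (2 / mu)]. It vanishes at [p], and since the
    quotient has a derivative of size [1 / eps] at [- eps], its Levi form at [p]
    is comparable to [|X'|^2 + eps ^ (2 / mu - 2) * |X_1|^2]; as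
    [eps ^ (1 / mu - 1) >= 1], this is, up to a constant factor, the square of
    the required bound.

    The pole at [2 * eps] prevents using [inner] on the whole domain. It is
    glued, by a maximum on [Re z_1 < eps], to
      [outer z = 2 * e * |z'|^2 * |z_1 + eps|^c], [c = 1 / (1 - ln eps)].
    The exponent is so small that [|z_1 + eps|^c] lies between [1 / e] and a
    constant on the part of the domain with [|z_1 + eps| >= eps], while the
    factor still tends to 0 at [z_1 = - eps]. Hence:
    - near [p], [outer <= |z'|^2 <= inner], so the maximum is [inner], which is
      smooth there ([competitor_near_center]);
    - if [eps / 2 <= Re z_1 < eps] in the domain, some [|z_j|^mu] is at least
      [eps / (2 * m)], so [|z'|^2] dominates the second term of [inner] and
      [inner <= 2 * |z'|^2 <= outer] ([inner_le_outer]): the maximum is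
      [outer], which continues to the rest of the domain.

    Logarithmic plurisubharmonicity is checked on complex lines. All functions
    above are built from squared moduli of affine functions by sums, products,
    positive powers, maxima and, off zeros, inverses. The property used for this
    induction is [log_minorized]: at each point where the function is positive,
    its logarithm has a minorant that touches it there and has the mean value
    property on small circles. It gives the submean inequality for the function
    and for its logarithm ([log_minorized_submean]), and the closure under sums
    is the concavity of the logarithm ([log_minorizedD]). It starts from the
    mean value property of [log |a w + b|] off its zero, which comes from the
    doubling of the angle ([turn_integral_log]). *)

Set Implicit Arguments.
Unset Strict Implicit.
Unset Printing Implicit Defensive.

Local Open Scope classical_set_scope.
Local Open Scope complex_scope.
Local Open Scope ring_scope.

(** * Integration over the circle *)

Section CircleIntegrals.
Context {R : realType}.
Implicit Types (phi psi : R -> R).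
Notation mu := (@lebesgue_measure R).

Definition turn_integral phi : R := (\int[mu]_(t in `[0, 2 * pi]) phi t)%R.

Lemma integrable_turn phi : continuous phi ->
  mu.-integrable `[0, 2 * pi] (EFin \o phi).
Proof.
move=> cphi; apply: continuous_compact_integrable; first exact: segment_compact.
exact: continuous_subspaceT.
Qed.

Lemma EFin_turn_integral phi : continuous phi ->
  (\int[mu]_(t in `[0%R, (2 * pi)%R]) (phi t)%:E = (turn_integral phi)%:E)%E.
Proof.
move=> cphi; rewrite /turn_integral /Rintegral fineK//.
apply: (integrable_fin_num _ (integrable_turn cphi)).
exact: measurable_itv.
Qed.

Lemma turn_integralD phi psi : continuous phi -> continuous psi ->
  turn_integral (fun t => phi t + psi t) =
  turn_integral phi + turn_integral psi.
Proof.
move=> cphi cpsi; rewrite /turn_integral RintegralD//.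
- exact: integrable_turn.
- exact: integrable_turn.
Qed.

Lemma turn_integralZ phi c : continuous phi ->
  turn_integral (fun t => c * phi t) = c * turn_integral phi.
Proof.
by move=> cphi; rewrite /turn_integral RintegralZl//; exact: integrable_turn.
Qed.

Lemma turn_integral_cst c : turn_integral (fun=> c) = 2 * pi * c.
Proof.
rewrite /turn_integral Rintegral_cst//= lebesgue_measure_itv/= lte_fin.
by rewrite mulr_gt0 ?pi_gt0//= subr0 mulrC.
Qed.

Lemma le_turn_integral phi psi : continuous phi -> continuous psi ->
  (forall t, phi t <= psi t) -> turn_integral phi <= turn_integral psi.
Proof.
move=> cphi cpsi h; apply: le_Rintegral => //; first exact: integrable_turn.
exact: integrable_turn.
Qed.

Lemma continuous_primitive phi (M : R) : continuous phi ->
  exists F : R -> R, forall x, - M < x < M -> is_derive x 1 F (phi x).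
Proof.
move=> cphi; exists (fun x => \int[mu]_(t in `[- M, x]) phi t)%R.
move=> x /andP[Mx xM].
have int : mu.-integrable `[- M, M] (EFin \o phi).
  apply: continuous_compact_integrable; first exact: segment_compact.
  exact: continuous_subspaceT.
have [dF dFE] := continuous_FTC1_closed xM int Mx (cphi x).
by split; [exact: dF | rewrite -derive1E].
Qed.

Lemma turn_integral_primitive phi F : continuous phi ->
  (forall x, 0 <= x <= 2 * pi -> is_derive x 1 F (phi x)) ->
  turn_integral phi = F (2 * pi) - F 0.
Proof.
move=> cphi dF; have pi0 : 0 < 2 * pi :> R by rewrite mulr_gt0 ?pi_gt0.
apply: EFin_inj; rewrite -EFin_turn_integral// EFinB.
have cF x : 0 <= x <= 2 * pi -> {for x, continuous F}.
  by move=> /dF[dFx _]; exact/differentiable_continuous/derivable1_diffP.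
apply: (continuous_FTC2 pi0); first exact: continuous_subspaceT.
- split.
  + move=> x; rewrite in_itv /= => /andP[/ltW x0 /ltW x2].
    by case: (dF x); rewrite ?x0.
  + by apply: cvg_at_right_filter; apply: cF; rewrite lexx ltW.
  + by apply: cvg_at_left_filter; apply: cF; rewrite lexx ltW.
- move=> x; rewrite in_itv /= => /andP[/ltW x0 /ltW x2]; rewrite derive1E.
  by case: (dF x); rewrite ?x0.
Qed.

(** Halving the circle: the left-hand sides exhaust the values of [phi] over a
    whole turn when [t] runs over half a turn, and then [2 * t] makes one whole
    turn. *)
Lemma turn_integral_double phi psi : continuous phi -> continuous psi ->
  (forall t, phi t + phi (t + pi) = psi (2 * t)) ->
  turn_integral phi = turn_integral psi / 2.
Proof.
move=> cphi cpsi h; have pi0 := @pi_gt0 R.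
have [F dF] := continuous_primitive (4 * pi) cphi.
have [H dH] := continuous_primitive (4 * pi) cpsi.
have -> : turn_integral phi = F (2 * pi) - F 0.
  by apply: turn_integral_primitive => // x /andP[? ?]; apply: dF; lra.
have -> : turn_integral psi = H (2 * pi) - H 0.
  by apply: turn_integral_primitive => // x /andP[? ?]; apply: dH; lra.
pose D x := F x + F (x + pi) - 2^-1 * H (2 * x).
have dD x : 0 <= x <= pi -> is_derive x 1 D 0.
  move=> /andP[x0 x1].
  have d2 : is_derive x 1 ( *%R 2 : R -> R) 2.
    by apply: is_derive_eq; rewrite /GRing.scale /= mulr1.
  have dpi : is_derive x 1 (fun y => y + pi) 1.
    by apply: is_derive_eq; rewrite addr0.
  have dF0 : is_derive x 1 F (phi x) by apply: dF; lra.
  have dF1 : is_derive (x + pi) 1 F (phi (x + pi)) by apply: dF; lra.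
  have dH0 : is_derive (2 * x) 1 H (psi (2 * x)) by apply: dH; lra.
  have dF2 := @is_derive1_comp _ F (fun y => y + pi) x _ _ dF1 dpi.
  have dH2 := @is_derive1_comp _ H ( *%R 2) x _ _ dH0 d2.
  apply: is_derive_eq.
  by rewrite -h /GRing.scale /=; field.
have : D pi = D 0.
  have [||c _] := @MVT_segment R D (fun=> 0) 0 pi (ltW pi0).
  - by move=> x; rewrite in_itv /= => /andP[? ?]; apply: dD; lra.
  - apply: derivable_within_continuous => x; rewrite in_itv /= => xI.
    by case: (dD x xI).
  - by rewrite mul0r; lra.
rewrite /D mulr0 add0r (_ : pi + pi = 2 * pi); last by ring.
lra.
Qed.

End CircleIntegrals.

(** * Jensen's formula for an affine function *)

Section Modulus.
Context {R : realType}.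
Implicit Types z w : R[i].

Definition sqmod z : R := complex.Re z ^+ 2 + complex.Im z ^+ 2.

Lemma cmodK z : (cmod z)%:C = `|z|.
Proof. by rewrite /cmod normc_def. Qed.

Lemma cmodE z : cmod z = Num.sqrt (sqmod z).
Proof. by rewrite /cmod normc_def. Qed.

Lemma sqmod_ge0 z : 0 <= sqmod z.
Proof. by rewrite addr_ge0 ?sqr_ge0. Qed.

Lemma cmod_ge0 z : 0 <= cmod z.
Proof. by rewrite cmodE sqrtr_ge0. Qed.

Lemma sqr_cmod z : cmod z ^+ 2 = sqmod z.
Proof. by rewrite cmodE sqr_sqrtr ?sqmod_ge0. Qed.

Lemma cmodM z w : cmod (z * w) = cmod z * cmod w.
Proof. by apply: (@complexI R); rewrite rmorphM /= !cmodK normrM. Qed.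

Lemma cmodN z : cmod (- z) = cmod z.
Proof. by rewrite /cmod normrN. Qed.

Lemma ler_cmodD z w : cmod (z + w) <= cmod z + cmod w.
Proof. by rewrite -lecR rmorphD /= !cmodK ler_normD. Qed.

Lemma ler_cmodB z w : cmod z - cmod w <= cmod (z - w).
Proof. by rewrite lerBlDr (le_trans _ (ler_cmodD _ _))// subrK. Qed.

Lemma cmod_eq0 z : (cmod z == 0) = (z == 0).
Proof. by rewrite -(inj_eq (@complexI R)) cmodK normr_eq0. Qed.

Lemma cmod_gt0 z : (0 < cmod z) = (z != 0).
Proof. by rewrite lt_def cmod_ge0 andbT cmod_eq0. Qed.

Lemma cmodV z : cmod z^-1 = (cmod z)^-1.
Proof. by apply: (@complexI R); rewrite fmorphV !cmodK normfV. Qed.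

Lemma cmodR (x : R) : 0 <= x -> cmod x%:C = x.
Proof.
by move=> x0; rewrite cmodE /sqmod /= expr0n addr0 sqrtr_sqr ger0_norm.
Qed.

Lemma sqmodM z w : sqmod (z * w) = sqmod z * sqmod w.
Proof. by rewrite -!sqr_cmod cmodM exprMn. Qed.

Lemma sqmod_eq0 z : (sqmod z == 0) = (z == 0).
Proof. by rewrite -sqr_cmod sqrf_eq0 cmod_eq0. Qed.

Lemma sqmod_gt0 z : (0 < sqmod z) = (z != 0).
Proof. by rewrite lt_def sqmod_ge0 andbT sqmod_eq0. Qed.

Lemma ler_Re_cmod z : `|complex.Re z| <= cmod z.
Proof. by rewrite -lecR cmodK normc_ge_Re. Qed.

Lemma ler_Im_cmod z : `|complex.Im z| <= cmod z.
Proof.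
by rewrite cmodE -sqrtr_sqr ler_sqrt ?sqmod_ge0// lerDr sqr_ge0.
Qed.

Definition expi (t : R) : R[i] := cos t +i* sin t.

Lemma sqmod_expi t : sqmod (expi t) = 1.
Proof. exact: cos2Dsin2. Qed.

Lemma cmod_expi t : cmod (expi t) = 1.
Proof. by rewrite cmodE sqmod_expi sqrtr1. Qed.

Lemma expiDpi t : expi (t + pi) = - expi t.
Proof. by rewrite /expi cosDpi sinDpi. Qed.

Lemma expi_double t : expi (2 * t) = expi t ^+ 2.
Proof.
have -> : 2 * t = t *+ 2 by rewrite mulr_natl.
apply/eqP; rewrite eq_complex /= cos_mulr2n sin_mulr2n.
by rewrite -(cos2Dsin2 t); apply/andP; split; apply/eqP; ring.
Qed.

Lemma continuous_sqmod_circle (a b : R[i]) :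
  continuous (fun t : R => sqmod (a + b * expi t)).
Proof.
case: a b => [a1 a2] [b1 b2] t.
rewrite /sqmod /=; apply: cvgD; rewrite !expr2; apply: cvgM;
  apply: cvgD; [exact: cvg_cst|apply: cvgB|exact: cvg_cst|apply: cvgB|
    exact: cvg_cst|apply: cvgD|exact: cvg_cst|apply: cvgD];
  by apply: cvgM; [exact: cvg_cst|
    first [exact: continuous_cos|exact: continuous_sin]].
Qed.

End Modulus.

Section LogMean.
Context {R : realType}.
Implicit Types s z : R[i].

Let small s := cmod s <= 2^-1.

Let logc s (t : R) : R := ln (sqmod (1 - s * expi t)).

Let cmod_bounds s t : small s ->
  2^-1 <= cmod (1 - s * expi t) <= 2.
Proof.
move=> ss; have h : cmod (s * expi t) <= 2^-1 by rewrite cmodM cmod_expi mulr1.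
have c1 : cmod (1 : R[i]) = 1 by rewrite -[1]/(1%:C) cmodR.
apply/andP; split.
  by apply: le_trans (ler_cmodB _ _); rewrite c1; lra.
by apply: le_trans (ler_cmodD _ _) _; rewrite cmodN c1; lra.
Qed.

Let sqmod_pos s t : small s -> 0 < sqmod (1 - s * expi t).
Proof.
move=> /cmod_bounds-/(_ t)/andP[h _].
by rewrite -sqr_cmod exprn_gt0// (lt_le_trans _ h)// invr_gt0.
Qed.

Lemma continuous_ln_circle s : cmod s <= 2^-1 ->
  continuous (fun t => ln (sqmod (1 - s * expi t))).
Proof.
move=> ss t; have := @continuous_sqmod_circle R 1 (- s) t.
under eq_fun do rewrite mulNr.
move=> c1; exact: (cvg_comp _ _ c1 (continuous_ln (sqmod_pos t ss))).
Qed.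

Let logc_bound s t : small s -> `|logc s t| <= ln 4.
Proof.
move=> ss; have /andP[h1 h2] := cmod_bounds t ss.
rewrite ler_norml /logc -sqr_cmod.
have c0 : 0 < cmod (1 - s * expi t) by apply: lt_le_trans h1.
rewrite -lnV ?posrE// !ler_ln ?posrE ?exprn_gt0 ?invr_gt0//.
by apply/andP; split; nra.
Qed.

Let small_sqr s : small s -> small (s ^+ 2).
Proof. rewrite /small expr2 cmodM; have := cmod_ge0 s; nra. Qed.

Let logc_double s : small s ->
  turn_integral (logc s) = turn_integral (logc (s ^+ 2)) / 2.
Proof.
move=> ss; apply: turn_integral_double.
- exact: continuous_ln_circle.
- exact/continuous_ln_circle/small_sqr.
- move=> t; have p1 := sqmod_pos t ss; have p2 := sqmod_pos (t + pi) ss.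
  rewrite /logc -lnM ?posrE// -sqmodM expiDpi expi_double.
  by congr (ln (sqmod _)); ring.
Qed.

(** Jensen's formula for a zero-free affine function. Multiplying the values
    at antipodal points, [(1 - w) * (1 + w) = 1 - w ^+ 2], shows that the
    integral [J s] satisfies [J s = J (s ^+ 2) / 2]; as [J] is bounded on the
    disc of radius 1/2, iterating this relation forces [J s = 0]. *)
Lemma turn_integral_log s : cmod s <= 2^-1 ->
  turn_integral (fun t => ln (sqmod (1 - s * expi t))) = 0.
Proof.
move=> ss; pose C : R := 2 * pi * ln 4.
have bnd k : forall s', small s' -> `|turn_integral (logc s')| <= C / 2 ^+ k.
  elim: k => [|k IH] s' ss'.
    have c0 := continuous_ln_circle ss'.
    rewrite expr0 divr1 ler_norml /C -mulrN -!turn_integral_cst.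
    apply/andP; split; apply: le_turn_integral => //; try exact: cst_continuous.
      by move=> t; have := logc_bound t ss'; rewrite ler_norml => /andP[].
    by move=> t; have := logc_bound t ss'; rewrite ler_norml => /andP[].
  rewrite logc_double// normrM (@ger0_norm _ 2^-1) ?invr_ge0// (exprSr 2 k).
  by rewrite invfM mulrA ler_wpM2r ?invr_ge0// IH// small_sqr.
apply/eqP; rewrite -normr_eq0 -[_ == _]negbK; apply/negP => J0.
have {}J0 : 0 < `|turn_integral (logc s)| by rewrite lt_def J0 normr_ge0.
have C0 : 0 <= C.
  by have := le_trans (normr_ge0 _) (bnd 0%N _ ss); rewrite expr0 divr1.
have := bnd (Num.bound (C / `|turn_integral (logc s)|)) s ss.
apply/negP; rewrite -ltNge ltr_pdivrMr ?exprn_gt0//.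
rewrite -ltr_pdivrMl// mulrC (lt_trans (archi_boundP _))//.
  by rewrite divr_ge0.
by rewrite -natrX ltr_nat ltn_expl.
Qed.

End LogMean.

(** * Functions with a harmonic minorant of the logarithm *)

Section PointwiseIntegral.
Context (d : measure_display) (T : measurableType d) (R : realType).

(** The integral is the difference of two suprema over simple functions, below
    the positive and below the negative part of the integrand, and each
    supremum is monotone in the integrand. In this form it compares an
    arbitrary function with a continuous minorant. *)
Lemma le_integral_pointwise (mu : {measure set T -> \bar R}) (D : set T)
    (f g : T -> \bar R) : (forall x, D x -> (f x <= g x)%E) ->
  (\int[mu]_(x in D) f x <= \int[mu]_(x in D) g x)%E.
Proof.
move=> fg; rewrite /integral; have fgD := lee_restrict fg.
apply: leeB; apply: ereal_sup_le => _ [h hf <-];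
  exists h => // x; apply: le_trans (hf x) _.
  by apply: (@funepos_le _ _ setT) => //; rewrite in_setT.
by apply: (@funeneg_le _ _ setT) => //; rewrite in_setT.
Qed.

End PointwiseIntegral.

Section NearDisc.
Context {R : realType}.

Lemma near_disc (z : R[i]) (P : R[i] -> Prop) :
  (\forall w \near z, P w) <->
  exists2 rho : R, 0 < rho & forall w, cmod (w - z) < rho -> P w.
Proof.
split=> [/nbhs_ballP [e /= e0 eP]|[r r0 rP]].
  have eE : e = (complex.Re e)%:C by rewrite RRe_real// gtr0_real.
  exists (complex.Re e); first by rewrite -ltcR -eE.
  by move=> w wz; apply: eP; rewrite -ball_normE/= distrC eE -cmodK ltcR.
apply/nbhs_ballP; exists r%:C => /=; first by rewrite ltcR.
by move=> w; rewrite -ball_normE/= distrC -cmodK ltcR => /rP.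
Qed.

End NearDisc.

Section MeanValue.
Context {R : realType}.
Implicit Types (z w : R[i]) (L : R[i] -> R) (E : R[i] -> R).

Definition mean_value z L := exists2 rho : R, 0 < rho &
  forall r, 0 < r < rho ->
    continuous (fun t => L (z + r%:C * expi t)) /\
    turn_integral (fun t => L (z + r%:C * expi t)) = 2 * pi * L z.

Lemma mean_value_cst z c : mean_value z (fun=> c).
Proof.
exists 1 => // r _; split; first exact: cst_continuous.
exact: turn_integral_cst.
Qed.

Lemma mean_valueD z L1 L2 : mean_value z L1 -> mean_value z L2 ->
  mean_value z (fun w => L1 w + L2 w).
Proof.
move=> [r1 r10 h1] [r2 r20 h2]; exists (Num.min r1 r2).
  by rewrite lt_min r10.
move=> r; rewrite lt_min => /andP[r0 /andP[rr1 rr2]].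
have [|c1 i1] := h1 r; first by rewrite r0.
have [|c2 i2] := h2 r; first by rewrite r0.
split; first by move=> t; apply: cvgD; [exact: c1|exact: c2].
by rewrite (turn_integralD c1 c2) i1 i2; ring.
Qed.

Lemma mean_valueZ z c L : mean_value z L -> mean_value z (fun w => c * L w).
Proof.
move=> [r1 r10 h1]; exists r1 => // r /h1[c1 i1].
split; first by move=> t; apply: cvgM; [exact: cvg_cst|exact: c1].
by rewrite (turn_integralZ c c1) i1; ring.
Qed.

(** After dividing by the value at the centre, the circle integral becomes the
    one of [turn_integral_log]; the bound on the radius keeps the parameter
    [s] at modulus at most 1/2. *)
Lemma mean_value_ln_affine z (al be : R[i]) : al * z + be != 0 ->
  mean_value z (fun w => ln (sqmod (al * w + be))).
Proof.
set v := al * z + be => v0; have cv0 : 0 < cmod v by rewrite cmod_gt0.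
have ca := cmod_ge0 al.
exists (cmod v / (2 * (cmod al + 1))).
  by rewrite divr_gt0// mulr_gt0//; lra.
move=> r /andP[r0]; rewrite ltr_pdivlMr ?mulr_gt0//; last by lra.
move=> hr; pose s := - (al * r%:C / v).
have ss : cmod s <= 2^-1.
  rewrite cmodN !cmodM cmodV (cmodR (ltW r0)) ler_pdivrMr//.
  by nra.
have sE t : al * (z + r%:C * expi t) + be = v * (1 - s * expi t).
  rewrite /s /v; field; exact: v0.
have lnE t : ln (sqmod (al * (z + r%:C * expi t) + be)) =
    ln (sqmod v) + ln (sqmod (1 - s * expi t)).
  rewrite sE sqmodM lnM ?posrE ?sqmod_gt0//.
  rewrite -cmod_gt0 (lt_le_trans _ (ler_cmodB _ _))//.
  by rewrite -[1]/(1%:C) cmodR// cmodM cmod_expi mulr1; lra.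
have cln : continuous (fun t => ln (sqmod (1 - s * expi t))).
  exact: continuous_ln_circle.
under eq_fun do rewrite lnE.
split; first by move=> t; apply: cvgD; [exact: cvg_cst|exact: cln].
rewrite (@turn_integralD _ (fun=> _))//; last exact: cst_continuous.
by rewrite turn_integral_cst turn_integral_log// addr0.
Qed.

End MeanValue.

Section LogMinorant.
Context {R : realType}.
Implicit Types (z w : R[i]) (L E : R[i] -> R).

(** A local certificate that both [E] and [log E] satisfy the submean
    inequality at [z]: where [E] does not vanish, [log E] has a minorant that
    touches it at [z] and has the mean value property there. *)
Definition log_minorized z E := (forall w, 0 <= E w) /\
  (E z = 0 \/ exists2 L, mean_value z L &
     E z = expR (L z) /\ \forall w \near z, expR (L w) <= E w).

Lemma log_minorized_le z E E' : log_minorized z E -> (forall w, 0 <= E' w) ->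
  E' z = E z -> (\forall w \near z, E w <= E' w) -> log_minorized z E'.
Proof.
move=> [E0 h] E'0 eqz leE; split=> //; rewrite eqz.
case: h => [->|]; first by left.
move=> [L mL [LE nL]]; right; exists L => //; split=> //.
by near=> w; apply: le_trans (near nL w _) (near leE w _).
Unshelve. all: by end_near. Qed.

Lemma log_minorized_cst z c : 0 <= c -> log_minorized z (fun=> c).
Proof.
move=> c0; split=> //; move: c0; rewrite le_eqVlt => /predU1P[->|c0].
  by left.
right; exists (fun=> ln c); first exact: mean_value_cst.
by rewrite lnK ?posrE//; split=> //; near=> w.
Unshelve. all: by end_near. Qed.

Lemma log_minorizedM z E1 E2 : log_minorized z E1 -> log_minorized z E2 ->
  log_minorized z (fun w => E1 w * E2 w).
Proof.
move=> [E10 h1] [E20 h2]; split; first by move=> w; rewrite mulr_ge0.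
case: h1 => [->|[L1 m1 [e1 n1]]]; first by left; rewrite mul0r.
case: h2 => [->|[L2 m2 [e2 n2]]]; first by left; rewrite mulr0.
right; exists (fun w => L1 w + L2 w); first exact: mean_valueD.
rewrite e1 e2 expRD; split=> //; near=> w.
rewrite expRD ler_pM ?expR_ge0//; first exact: (near n1 w _).
exact: (near n2 w _).
Unshelve. all: by end_near. Qed.

Lemma log_minorized_powR z E p : 0 < p -> log_minorized z E ->
  log_minorized z (fun w => E w `^ p).
Proof.
move=> p0 [E0 h]; split; first by move=> w; rewrite powR_ge0.
case: h => [->|[L mL [eL nL]]]; first by left; rewrite powR0// gt_eqF.
right; exists (fun w => p * L w); first exact: mean_valueZ.
rewrite eL -expRM mulrC; split=> //; near=> w.
rewrite mulrC expRM ge0_ler_powR ?nnegrE ?expR_ge0 ?(ltW p0)//.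
exact: (near nL w _).
Unshelve. all: by end_near. Qed.

(** The minorant of the sum is the convex combination of the two minorants
    whose weights are the proportions of the two terms at [z]; it lies below
    by concavity of the logarithm. *)
Lemma log_minorizedD z E1 E2 : log_minorized z E1 -> log_minorized z E2 ->
  log_minorized z (fun w => E1 w + E2 w).
Proof.
move=> h1 h2; have [E10 _] := h1; have [E20 _] := h2.
have E0 w : 0 <= E1 w + E2 w by rewrite addr_ge0.
have [E1z|[L1 m1 [e1 n1]]] := h1.2.
  apply: (log_minorized_le h2) => //; first by rewrite E1z add0r.
  by near=> w; rewrite lerDr.
have [E2z|[L2 m2 [e2 n2]]] := h2.2.
  apply: (log_minorized_le h1) => //; first by rewrite E2z addr0.
  by near=> w; rewrite lerDl.
split=> //; right; pose S := E1 z + E2 z.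
have E1p : 0 < E1 z by rewrite e1 expR_gt0.
have E2p : 0 < E2 z by rewrite e2 expR_gt0.
have S0 : 0 < S by rewrite addr_gt0.
pose p1 := E1 z / S; pose p2 := E2 z / S.
have p10 : 0 < p1 by rewrite divr_gt0.
have p20 : 0 < p2 by rewrite divr_gt0.
have p12 : p1 + p2 = 1 by rewrite -mulrDl divff// gt_eqF.
pose D w := p1 * (L1 w + - L1 z) + p2 * (L2 w + - L2 z).
exists (fun w => D w + ln S).
  apply: mean_valueD; last exact: mean_value_cst.
  apply: mean_valueD; apply: mean_valueZ; apply: mean_valueD => //;
    exact: mean_value_cst.
rewrite /D !subrr !mulr0 !add0r lnK ?posrE//; split=> //; near=> w.
rewrite expRD lnK ?posrE//.
apply: (@le_trans _ _ (expR (L1 w) + expR (L2 w))); last first.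
  by rewrite lerD//; [exact: (near n1 w _)|exact: (near n2 w _)].
have x1 : expR (L1 w) = p1 * S * expR (D w) * expR (L1 w - L1 z - D w).
  by rewrite /p1 divfK ?gt_eqF// e1 -!expRD; congr expR; ring.
have x2 : expR (L2 w) = p2 * S * expR (D w) * expR (L2 w - L2 z - D w).
  by rewrite /p2 divfK ?gt_eqF// e2 -!expRD; congr expR; ring.
rewrite x1 x2 -/(D w).
have SD : 0 < S * expR (D w) by rewrite mulr_gt0 ?expR_gt0.
have y1 := expR_ge1Dx (L1 w - L1 z - D w).
have y2 := expR_ge1Dx (L2 w - L2 z - D w).
have key : 1 <= p1 * expR (L1 w - L1 z - D w) + p2 * expR (L2 w - L2 z - D w).
  apply: (@le_trans _ _ (p1 * (1 + (L1 w - L1 z - D w)) +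
                         p2 * (1 + (L2 w - L2 z - D w)))); last first.
    by rewrite lerD// ler_pM2l.
  rewrite le_eqVlt; apply/orP; left; apply/eqP.
  transitivity ((p1 + p2) * (1 - D w) + D w); last by rewrite {2}/D; ring.
  by rewrite p12; ring.
rewrite mulrC -[leLHS]mulr1 -!(mulrA p1) -!(mulrA p2).
rewrite (mulrCA p1) (mulrCA p2) -mulrDr.
by rewrite ler_pM2l.
Unshelve. all: by end_near. Qed.

Lemma log_minorized_sum z (I : finType) (E : I -> R[i] -> R) :
  (forall i, log_minorized z (E i)) ->
  log_minorized z (fun w => \sum_i E i w).
Proof.
move=> h; pose S (s : seq I) w := \sum_(i <- s) E i w.
suff : forall s, log_minorized z (S s) by apply.
elim=> [|i s IH].
  have -> : S [::] = fun=> 0 by apply/funext => w; rewrite /S big_nil.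
  exact: log_minorized_cst.
have -> : S (i :: s) = fun w => E i w + S s w.
  by apply/funext => w; rewrite /S big_cons.
exact: log_minorizedD.
Qed.

Lemma log_minorized_max z E1 E2 : log_minorized z E1 -> log_minorized z E2 ->
  log_minorized z (fun w => Num.max (E1 w) (E2 w)).
Proof.
move=> h1 h2; have [E10 _] := h1; have [E20 _] := h2.
have E0 w : 0 <= Num.max (E1 w) (E2 w) by rewrite le_max E10.
have [le12|/ltW le21] := leP (E1 z) (E2 z).
  apply: (log_minorized_le h2) => //; first exact/max_idPr.
  by near=> w; rewrite le_max lexx orbT.
apply: (log_minorized_le h1) => //; first exact/max_idPl.
by near=> w; rewrite le_max lexx.
Unshelve. all: by end_near. Qed.

Lemma near_affine_neq0 z (al be : R[i]) : al * z + be != 0 ->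
  \forall w \near z, al * w + be != 0.
Proof.
move=> v0; apply/near_disc.
exists (cmod (al * z + be) / (cmod al + 1)).
  by rewrite divr_gt0 ?cmod_gt0// ltr_wpDl ?cmod_ge0.
move=> w; rewrite ltr_pdivlMr ?ltr_wpDl ?cmod_ge0// => hw.
have : cmod (al * z + be) - cmod (al * (z - w)) <= cmod (al * w + be).
  rewrite (_ : al * w + be = al * z + be - al * (z - w)); last by ring.
  exact: ler_cmodB.
rewrite -cmod_gt0; apply: lt_le_trans.
rewrite subr_gt0 cmodM -opprB cmodN mulrC (le_lt_trans _ hw)//.
by rewrite ler_wpM2l ?cmod_ge0// lerDl.
Qed.

Lemma log_minorized_affine z (al be : R[i]) :
  log_minorized z (fun w => sqmod (al * w + be)).
Proof.
split; first by move=> w; exact: sqmod_ge0.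
have [->|v0] := eqVneq (al * z + be) 0.
  by left; apply/eqP; rewrite sqmod_eq0.
right; exists (fun w => ln (sqmod (al * w + be))).
  exact: mean_value_ln_affine.
split; first by rewrite lnK// posrE sqmod_gt0.
have n := near_affine_neq0 v0; near=> w.
by rewrite lnK// posrE sqmod_gt0; exact: (near n w _).
Unshelve. all: by end_near. Qed.

Lemma log_minorized_inv_affine z (al be : R[i]) : al * z + be != 0 ->
  log_minorized z (fun w => (sqmod (al * w + be))^-1).
Proof.
move=> v0; split; first by move=> w; rewrite invr_ge0 sqmod_ge0.
right; exists (fun w => - 1 * ln (sqmod (al * w + be))).
  exact/mean_valueZ/mean_value_ln_affine.
split; first by rewrite mulN1r expRN lnK// posrE sqmod_gt0.
have n := near_affine_neq0 v0; near=> w.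
by rewrite mulN1r expRN lnK// posrE sqmod_gt0; exact: (near n w _).
Unshelve. all: by end_near. Qed.

Lemma circle_mean_ge (v : R[i] -> \bar R) z (r : R) (phi : R -> R) :
  continuous phi -> (forall t, ((phi t)%:E <= v (z + r%:C * expi t)%R)%E) ->
  (((2 * pi)^-1 * turn_integral phi)%R%:E <= circle_mean v z r)%E.
Proof.
move=> cphi h; rewrite EFinM /circle_mean lee_pmul2l//; last first.
  by rewrite lte_fin invr_gt0 mulr_gt0 ?pi_gt0.
by rewrite -EFin_turn_integral//; apply: le_integral_pointwise => t _.
Qed.

(** For [log E] the minorant [L] is integrated directly. For [E] itself it is
    replaced by the tangent [E z * (1 + L w - L z)], which lies below
    [expR (L w)] by convexity of the exponential and still has the mean value
    property. *)
Lemma log_minorized_submean z E : log_minorized z E ->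
  exists2 rho : R, 0 < rho & forall r : R, 0 < r < rho ->
    ((E z)%:E <= circle_mean (fun w => (E w)%:E) z r)%E /\
    (lne (E z)%:E <= circle_mean (fun w => lne (E w)%:E) z r)%E.
Proof.
have pi0 : 0 < 2 * pi :> R by rewrite mulr_gt0 ?pi_gt0.
move=> [E0 [Ez|[L [r1 r10 h1] [eL /near_disc[r2 r20 h2]]]]].
  exists 1 => // r _; rewrite Ez; split; last by rewrite le0_lneNy ?leNye.
  rewrite /circle_mean mule_ge0//; first by rewrite lee_fin invr_ge0 ltW.
  by apply: integral_ge0 => t _; rewrite lee_fin.
exists (Num.min r1 r2); first by rewrite lt_min r10.
move=> r; rewrite lt_min => /andP[r0 /andP[rr1 rr2]].
have [|cL iL] := h1 r; first by rewrite r0.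
have lowL t : expR (L (z + r%:C * expi t)) <= E (z + r%:C * expi t).
  apply: h2; rewrite addrC addKr cmodM cmod_expi mulr1 cmodR//; exact: ltW.
split.
- pose phi t := E z * (1 - L z) + E z * L (z + r%:C * expi t).
  have cphi : continuous phi.
    move=> t; apply: cvgD; first exact: cvg_cst.
    by apply: cvgM; [exact: cvg_cst|exact: cL].
  have -> : E z = (2 * pi)^-1 * turn_integral phi.
    rewrite (@turn_integralD _ (fun=> _))//; last 2 first.
    - exact: cst_continuous.
    - by move=> t; apply: cvgM; [exact: cvg_cst|exact: cL].
    rewrite turn_integral_cst turn_integralZ// iL.
    move: pi0; set p := 2 * pi => p0.
    by field; rewrite gt_eqF.
  apply: circle_mean_ge => // t; rewrite lee_fin; apply: le_trans (lowL t).
  rewrite /phi eL -[L (z + _)](subrK (L z)) expRD [leRHS]mulrC.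
  have -> : forall x, expR (L z) * (1 - L z) + expR (L z) * (x + L z) =
      expR (L z) * (1 + x) by move=> x; ring.
  by rewrite ler_pM2l ?expR_gt0// expR_ge1Dx.
- rewrite eL lne_EFin ?expR_gt0// expRK.
  have -> : L z = (2 * pi)^-1 * turn_integral (fun t => L (z + r%:C * expi t)).
    by rewrite iL mulKf// gt_eqF.
  apply: circle_mean_ge => // t.
  have E_gt0 := lt_le_trans (expR_gt0 _) (lowL t).
  rewrite lne_EFin// lee_fin.
  by rewrite -[leLHS]expRK ler_ln ?posrE ?expR_gt0.
Qed.

End LogMinorant.

(** * Smooth functions along real lines *)

Section LocalTopology.
Context {R : realType}.

Lemma continuous_line n (z v : 'rV[R[i]]_n) :
  continuous (fun l : R[i] => z + l *: v).
Proof.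
move=> l; have cz : (fun _ : R[i] => z) x @[x --> l] --> z.
  exact: (@cvg_cst 'rV[R[i]]_n z R[i] (nbhs l)).
exact: (cvgD cz (@scalel_continuous R[i] 'rV[R[i]]_n v l)).
Qed.

Lemma near_real_line n (z v : 'rV[R[i]]_n) (V : set 'rV[R[i]]_n) :
  open V -> V z -> \forall t \near (0 : R), V (z + t%:C *: v).
Proof.
move=> oV Vz.
have : \forall l \near (0 : R[i]), V (z + l *: v).
  apply: (@continuous_line n z v 0); apply: open_nbhs_nbhs.
  by rewrite scale0r addr0.
move=> /near_disc[r r0 rP]; near=> t; apply: rP.
rewrite subr0 /cmod normc_def /= expr0n addr0 sqrtr_sqr.
by near: t; exists r => // t /=; rewrite sub0r normrN.
Unshelve. all: by end_near. Qed.

End LocalTopology.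

Section SmoothCalculus.
Context {R : realType} {n : nat}.
Local Notation Cn := 'rV[R[i]]_n.
Implicit Types (z v w : Cn) (u : Cn -> R) (V : set Cn).

Definition along z v u (t : R) : R := u (z + t%:C *: v).

Lemma along0 z v u : along z v u 0 = u z.
Proof. by rewrite /along scale0r addr0. Qed.

Lemma rderivE v u z : rderiv v u z = 'D_1 (along z v u) 0.
Proof. by rewrite /rderiv derive1E. Qed.

Lemma near_along V z v u1 u2 : open V -> V z -> {in V, u1 =1 u2} ->
  \forall t \near (0 : R), along z v u1 t = along z v u2 t.
Proof.
move=> oV Vz h; near=> t; apply: h; rewrite inE.
by near: t; exact: near_real_line.
Unshelve. all: by end_near. Qed.

Lemma eq_in_rderiv V v u1 u2 : open V -> {in V, u1 =1 u2} ->
  {in V, rderiv v u1 =1 rderiv v u2}.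
Proof.
move=> oV h z; rewrite inE => Vz; rewrite !rderivE.
exact/near_eq_derive/near_along/h.
Qed.

Lemma eq_in_derivable V z v u1 u2 : open V -> V z -> {in V, u1 =1 u2} ->
  derivable (along z v u1) 0 1 -> derivable (along z v u2) 0 1.
Proof. by move=> oV Vz h; apply: near_eq_derivable; exact: near_along h. Qed.

Lemma eq_in_continuous V z u1 u2 : open V -> V z -> {in V, u1 =1 u2} ->
  {for z, continuous u1} -> {for z, continuous u2}.
Proof.
move=> oV Vz h c1; rewrite /prop_for /continuous_at -(h z) ?inE//.
apply: (cvg_trans _ c1); apply: (@near_eq_cvg _ _ (nbhs z)).
have nV : \forall w \near z, V w by exact: open_nbhs_nbhs.
by apply: filterS nV => w Vw; apply: h; rewrite inE.
Qed.

(** Derivatives are taken along all real lines, not only along the coordinate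
    directions, so that the class is stable under the rules below with a
    single direction variable; for [k = 2] it implies [C2_on]. *)
Fixpoint smooth (k : nat) V u : Prop :=
  (forall z, V z -> {for z, continuous u}) /\
  if k is k'.+1 then forall v,
    (forall z, V z -> derivable (along z v u) 0 1) /\ smooth k' V (rderiv v u)
  else True.

Lemma smooth_continuous k V u z : smooth k V u -> V z -> {for z, continuous u}.
Proof. by case: k => [|k] [h _]; exact: h. Qed.

Lemma smoothS k V u : smooth k.+1 V u -> smooth k V u.
Proof.
elim: k u => [|k IH] u [c h]; split=> // v; have [d s] := h v.
by split=> //; exact: IH.
Qed.

Lemma eq_smooth k V u1 u2 : open V -> {in V, u1 =1 u2} ->
  smooth k V u1 -> smooth k V u2.
Proof.
move=> oV; elim: k u1 u2 => [|k IH] u1 u2 h [c1 s1]; split => //.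
- by move=> z Vz; exact: (eq_in_continuous oV Vz h (c1 z Vz)).
- by move=> z Vz; exact: (eq_in_continuous oV Vz h (c1 z Vz)).
- move=> v; have [d s] := s1 v; split.
    by move=> z Vz; exact: (eq_in_derivable oV Vz h (d z Vz)).
  by apply: IH s; exact: eq_in_rderiv.
Qed.

Lemma smooth_C2 V u : smooth 2 V u -> C2_on V u.
Proof.
move=> [_ h]; split=> [j v _ z Vz|j v _ j' v' _ z Vz].
  have [d s] := h v; split; first exact: d.
  exact: s.1.
have [_ [_ /(_ v')[d s]]] := h v; split; first exact: d.
exact: s.1.
Qed.

Section Rules.
Variables (z v : Cn) (u1 u2 : Cn -> R).
Hypothesis d1 : derivable (along z v u1) 0 1.
Hypothesis d2 : derivable (along z v u2) 0 1.

Lemma rderivD :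
  rderiv v (fun x => u1 x + u2 x) z = rderiv v u1 z + rderiv v u2 z.
Proof. by rewrite !rderivE -deriveD. Qed.

Lemma rderivM : rderiv v (fun x => u1 x * u2 x) z =
  u1 z * rderiv v u2 z + u2 z * rderiv v u1 z.
Proof.
rewrite !rderivE -[u1 z](along0 z v) -[u2 z](along0 z v).
exact: (deriveM d1 d2).
Qed.

Lemma rderivV : u1 z != 0 ->
  rderiv v (fun x => (u1 x)^-1) z = - (u1 z)^-1 * (u1 z)^-1 * rderiv v u1 z.
Proof.
move=> u0; have a0 : along z v u1 0 != 0 by rewrite along0.
rewrite !rderivE; apply: (etrans (deriveV a0 d1)).
by rewrite along0 mulNr -invfM -expr2.
Qed.

End Rules.

Lemma smooth_cst k V c : smooth k V (fun=> c).
Proof.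
elim: k c => [|k IH] c; split=> //; try by move=> z _; exact: cst_continuous.
move=> v; split=> [z _|]; first exact: derivable_cst.
rewrite (_ : rderiv v _ = fun=> 0); first exact: IH.
by apply/funext => z; rewrite rderivE; exact: derive_cst.
Qed.

Lemma smoothD k V u1 u2 : open V -> smooth k V u1 -> smooth k V u2 ->
  smooth k V (fun z => u1 z + u2 z).
Proof.
move=> oV; elim: k u1 u2 => [|k IH] u1 u2 [c1 s1] [c2 s2]; split=> //.
- by move=> z Vz; exact: (continuousD (c1 z Vz) (c2 z Vz)).
- by move=> z Vz; exact: (continuousD (c1 z Vz) (c2 z Vz)).
- move=> v; have [d1 t1] := s1 v; have [d2 t2] := s2 v; split.
    by move=> z Vz; apply: derivableD; [exact: (d1 z Vz)|exact: (d2 z Vz)].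
  apply: (eq_smooth oV _ (IH _ _ t1 t2)) => z; rewrite inE => Vz.
  by rewrite rderivD//; [exact: (d1 z Vz)|exact: (d2 z Vz)].
Qed.

Lemma smoothM k V u1 u2 : open V -> smooth k V u1 -> smooth k V u2 ->
  smooth k V (fun z => u1 z * u2 z).
Proof.
move=> oV; elim: k u1 u2 => [|k IH] u1 u2 s1 s2.
  split=> // z Vz.
  exact: (continuousM (smooth_continuous s1 Vz) (smooth_continuous s2 Vz)).
split.
  move=> z Vz.
  exact: (continuousM (smooth_continuous s1 Vz) (smooth_continuous s2 Vz)).
move=> v; have [d1 t1] := s1.2 v; have [d2 t2] := s2.2 v; split.
  by move=> z Vz; apply: derivableM; [exact: (d1 z Vz)|exact: (d2 z Vz)].
have s := smoothD oV (IH _ _ (smoothS s1) t2) (IH _ _ (smoothS s2) t1).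
apply: (eq_smooth oV _ s) => z; rewrite inE => Vz.
by rewrite rderivM//; [exact: (d1 z Vz)|exact: (d2 z Vz)].
Qed.

Lemma smoothV k V u : open V -> (forall z, V z -> u z != 0) ->
  smooth k V u -> smooth k V (fun z => (u z)^-1).
Proof.
move=> oV u0; elim: k => [|k IH] s.
  by split=> // z Vz; exact: (continuousV (u0 z Vz) (smooth_continuous s Vz)).
split.
  by move=> z Vz; exact: (continuousV (u0 z Vz) (smooth_continuous s Vz)).
move=> v; have [d t] := s.2 v; split.
  move=> z Vz; have a0 : along z v u 0 != 0 by rewrite along0 u0.
  exact: (derivableV a0 (d z Vz)).
have i := IH (smoothS s).
have s' := smoothM oV (smoothM oV (smoothM oV (smooth_cst k V (-1)) i) i) t.
apply: (eq_smooth oV _ s') => z; rewrite inE => Vz.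
by rewrite rderivV ?mulN1r//; [exact: (d z Vz)|exact: (u0 z Vz)].
Qed.

End SmoothCalculus.

(** * Coordinates, Hessian and Levi form *)

Section Coordinates.
Context {R : realType} {n : nat}.
Local Notation Cn := 'rV[R[i]]_n.
Implicit Types (z v w p X : Cn) (u : Cn -> R) (V : set Cn).

Lemma continuous_Re : continuous (@complex.Re R : R[i] -> R).
Proof.
move=> z; apply/(@cvgrPdist_lt R R R[i] (nbhs z)) => e e0.
have h : \forall w \near z, `|complex.Re z - complex.Re w| < e.
  apply/near_disc; exists e => // w wz; rewrite -normrN opprB.
  by apply: le_lt_trans wz; rewrite -raddfB ler_Re_cmod.
exact: h.
Qed.

Lemma continuous_Im : continuous (@complex.Im R : R[i] -> R).
Proof.
move=> z; apply/(@cvgrPdist_lt R R R[i] (nbhs z)) => e e0.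
have h : \forall w \near z, `|complex.Im z - complex.Im w| < e.
  apply/near_disc; exists e => // w wz; rewrite -normrN opprB.
  by apply: le_lt_trans wz; rewrite -raddfB ler_Im_cmod.
exact: h.
Qed.

Definition re_shift (j : 'I_n) (a : R) z : R := complex.Re (z 0 j) + a.
Definition im_shift (j : 'I_n) (a : R) z : R := complex.Im (z 0 j) + a.

Lemma continuous_re_shift j a : continuous (re_shift j a).
Proof.
move=> z; apply: (@continuousD _ _ _ (fun x : Cn => complex.Re (x 0 j))).
  apply: (continuous_comp (@coord_continuous R[i] 1 n 0 j z)).
  exact: continuous_Re.
exact: cst_continuous.
Qed.

Lemma continuous_im_shift j a : continuous (im_shift j a).
Proof.
move=> z; apply: (@continuousD _ _ _ (fun x : Cn => complex.Im (x 0 j))).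
  apply: (continuous_comp (@coord_continuous R[i] 1 n 0 j z)).
  exact: continuous_Im.
exact: cst_continuous.
Qed.

Lemma along_re_shift j a z v :
  along z v (re_shift j a) = fun t => re_shift j a z + t * complex.Re (v 0 j).
Proof.
apply/funext => t; rewrite /along /re_shift !mxE.
by case: (z 0 j) (v 0 j) => [x y] [x' y'] /=; ring.
Qed.

Lemma along_im_shift j a z v :
  along z v (im_shift j a) = fun t => im_shift j a z + t * complex.Im (v 0 j).
Proof.
apply/funext => t; rewrite /along /im_shift !mxE.
by case: (z 0 j) (v 0 j) => [x y] [x' y'] /=; ring.
Qed.

Lemma is_derive_line (a b : R) :
  is_derive (0 : R) (1 : R) (fun t : R => a + t * b) b.
Proof.
have -> : (fun t : R => a + t * b) = cst a + b \*: (id : R -> R).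
  by apply/funext => t; rewrite /= mulrC.
have h := is_deriveD (is_derive_cst a (0 : R) (1 : R))
  (is_deriveZ b (is_derive_id (0 : R) (1 : R))).
by apply: (is_derive_eq h); rewrite add0r; exact: mulr1.
Qed.

Lemma rderiv_re_shift j a v :
  rderiv v (re_shift j a) = fun=> complex.Re (v 0 j).
Proof.
apply/funext => z; rewrite rderivE along_re_shift.
by case: (is_derive_line (re_shift j a z) (complex.Re (v 0 j))).
Qed.

Lemma rderiv_im_shift j a v :
  rderiv v (im_shift j a) = fun=> complex.Im (v 0 j).
Proof.
apply/funext => z; rewrite rderivE along_im_shift.
by case: (is_derive_line (im_shift j a z) (complex.Im (v 0 j))).
Qed.

Lemma smooth_re_shift k V j a : smooth k V (re_shift j a).
Proof.
case: k => [|k]; split=> //; try by move=> z _; exact: continuous_re_shift.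
move=> v; split=> [z _|]; last by rewrite rderiv_re_shift; exact: smooth_cst.
rewrite along_re_shift.
by case: (is_derive_line (re_shift j a z) (complex.Re (v 0 j))).
Qed.

Lemma smooth_im_shift k V j a : smooth k V (im_shift j a).
Proof.
case: k => [|k]; split=> //; try by move=> z _; exact: continuous_im_shift.
move=> v; split=> [z _|]; last by rewrite rderiv_im_shift; exact: smooth_cst.
rewrite along_im_shift.
by case: (is_derive_line (im_shift j a z) (complex.Im (v 0 j))).
Qed.

Lemma sqmod_shiftE j (c : R[i]) : (fun z : Cn => sqmod (z 0 j + c)) =
  (fun z => re_shift j (complex.Re c) z * re_shift j (complex.Re c) z +
            im_shift j (complex.Im c) z * im_shift j (complex.Im c) z).
Proof. by apply/funext => z; rewrite /sqmod !raddfD -!expr2. Qed.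

Lemma smooth_sqmod_shift k V j (c : R[i]) : open V ->
  smooth k V (fun z : Cn => sqmod (z 0 j + c)).
Proof.
move=> oV; rewrite sqmod_shiftE.
by apply: smoothD => //; apply: smoothM => //;
  (exact: smooth_re_shift || exact: smooth_im_shift).
Qed.

End Coordinates.

Section Hessian.
Context {R : realType} {n : nat}.
Local Notation Cn := 'rV[R[i]]_n.
Implicit Types (z v w p X : Cn) (u : Cn -> R) (V : set Cn).

Definition hess u p v w : R := rderiv v (rderiv w u) p.

Definition coord_dot (j : 'I_n) v w : R :=
  complex.Re (v 0 j) * complex.Re (w 0 j) +
  complex.Im (v 0 j) * complex.Im (w 0 j).

Section Rules.
Variables (V : set Cn) (p : Cn).
Hypotheses (oV : open V) (Vp : V p).

Lemma eq_in_hess u1 u2 v w : {in V, u1 =1 u2} -> hess u1 p v w = hess u2 p v w.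
Proof.
move=> h; apply: (@eq_in_rderiv _ _ V v (rderiv w u1) (rderiv w u2) oV).
  exact: eq_in_rderiv.
by rewrite inE.
Qed.

Lemma hessD u1 u2 v w : smooth 2 V u1 -> smooth 2 V u2 ->
  hess (fun z => u1 z + u2 z) p v w = hess u1 p v w + hess u2 p v w.
Proof.
move=> s1 s2; have [d1 t1] := s1.2 w; have [d2 t2] := s2.2 w.
have e : {in V, rderiv w (fun z => u1 z + u2 z) =1
    (fun z => rderiv w u1 z + rderiv w u2 z)}.
  by move=> z; rewrite inE => Vz; rewrite (rderivD (d1 z Vz) (d2 z Vz)).
rewrite /hess (eq_in_rderiv v oV e) ?inE//.
exact: (rderivD ((t1.2 v).1 p Vp) ((t2.2 v).1 p Vp)).
Qed.

Lemma derivable_alongM z v u1 u2 :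
  derivable (along z v u1) 0 1 -> derivable (along z v u2) 0 1 ->
  derivable (along z v (fun x => u1 x * u2 x)) 0 1.
Proof. exact: derivableM. Qed.

Lemma hessM u1 u2 v w : smooth 2 V u1 -> smooth 2 V u2 ->
  hess (fun z => u1 z * u2 z) p v w =
  u1 p * hess u2 p v w + rderiv w u2 p * rderiv v u1 p +
  (u2 p * hess u1 p v w + rderiv w u1 p * rderiv v u2 p).
Proof.
move=> s1 s2; have [d1 t1] := s1.2 w; have [d2 t2] := s2.2 w.
have e : {in V, rderiv w (fun z => u1 z * u2 z) =1
    (fun z => u1 z * rderiv w u2 z + u2 z * rderiv w u1 z)}.
  by move=> z; rewrite inE => Vz; rewrite (rderivM (d1 z Vz) (d2 z Vz)).
rewrite /hess (eq_in_rderiv v oV e) ?inE//.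
have dv1 := (s1.2 v).1 p Vp; have dv2 := (s2.2 v).1 p Vp.
have dw1 := (t1.2 v).1 p Vp; have dw2 := (t2.2 v).1 p Vp.
rewrite (rderivD (derivable_alongM dv1 dw2) (derivable_alongM dv2 dw1)).
by rewrite (rderivM dv1 dw2) (rderivM dv2 dw1).
Qed.

Lemma hess_cst c v w : hess (fun=> c) p v w = 0.
Proof.
rewrite /hess (_ : rderiv w _ = fun=> 0).
  by rewrite rderivE; exact: derive_cst.
by apply/funext => z; rewrite rderivE; exact: derive_cst.
Qed.

Lemma hess_scale c u v w : smooth 2 V u ->
  hess (fun z => c * u z) p v w = c * hess u p v w.
Proof.
move=> s; rewrite (hessM v w (smooth_cst 2 V c) s).
rewrite hess_cst [rderiv w (fun=> c) p]rderivE [rderiv v (fun=> c) p]rderivE.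
by rewrite (derive_cst c (0 : R) (1 : R)) mul0r !mulr0 !addr0.
Qed.

Lemma smooth_hess_sum (I : Type) (s : seq I) (u : I -> Cn -> R) v w :
  (forall i, smooth 2 V (u i)) ->
  smooth 2 V (fun z => \sum_(i <- s) u i z) /\
  hess (fun z => \sum_(i <- s) u i z) p v w = \sum_(i <- s) hess (u i) p v w.
Proof.
move=> su; elim: s => [|i s [IHs IHh]].
  rewrite big_nil (_ : (fun z => \sum_(i <- [::]) u i z) = fun=> 0).
    by split; [exact: smooth_cst|exact: hess_cst].
  by apply/funext => z; rewrite big_nil.
rewrite big_cons (_ : (fun z => \sum_(i <- i :: s) u i z) =
    (fun z => u i z + \sum_(i <- s) u i z)); last first.
  by apply/funext => z; rewrite big_cons.
split; first exact: (smoothD oV (su i) IHs).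
by rewrite (hessD v w (su i) IHs) IHh.
Qed.

End Rules.

(** The functions [sqmod (z 0 j + c)] are the building blocks of the competitor
    whose Levi form is computed; where one of them vanishes, so does its
    gradient, which leaves a single term in the Hessian of a product. *)
Lemma hess_sqmod_shift p j (c : R[i]) v w :
  hess (fun z => sqmod (z 0 j + c)) p v w = 2 * coord_dot j v w.
Proof.
have sr := smooth_re_shift 2 setT j (complex.Re c).
have si := smooth_im_shift 2 setT j (complex.Im c).
have pT : setT p by [].
rewrite sqmod_shiftE.
rewrite (hessD openT pT v w (smoothM openT sr sr) (smoothM openT si si)).
rewrite (hessM openT pT v w sr sr) (hessM openT pT v w si si).
rewrite /hess !rderiv_re_shift !rderiv_im_shift.
have r0 (c' : R) : rderiv v (fun=> c') p = 0.
  by rewrite rderivE; exact: derive_cst.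
by rewrite !r0 /coord_dot; ring.
Qed.

Lemma rderiv_sqmod_shift0 p j (c : R[i]) v : p 0 j + c = 0 ->
  rderiv v (fun z => sqmod (z 0 j + c)) p = 0.
Proof.
move=> pc; rewrite sqmod_shiftE.
have sr := smooth_re_shift 1 setT j (complex.Re c).
have si := smooth_im_shift 1 setT j (complex.Im c).
have dr := (sr.2 v).1 p I; have di := (si.2 v).1 p I.
rewrite (rderivD (derivable_alongM dr dr) (derivable_alongM di di)).
rewrite (rderivM dr dr) (rderivM di di).
have -> : re_shift j (complex.Re c) p = 0 by rewrite /re_shift -raddfD pc.
have -> : im_shift j (complex.Im c) p = 0 by rewrite /im_shift -raddfD pc.
by rewrite !mul0r !addr0.
Qed.

(** At coordinate [l] the real second derivatives in the directions [xdir l]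
    and [ydir l] both equal [2 * c l], so that a quarter of their sum is [c l];
    all mixed terms vanish. *)
Lemma levi_diag u p X (c : 'I_n -> R) :
  (forall v w, hess u p v w = \sum_l c l * (2 * coord_dot l v w)) ->
  levi u p X = \sum_l c l * cmod (X 0 l) ^+ 2.
Proof.
move=> hu.
have xE (i l : 'I_n) : xdir i 0 l = (l == i)%:R :> R[i].
  by rewrite /xdir mxE eqxx.
have yE (i l : 'I_n) : ydir i 0 l = 'i%C * (l == i)%:R :> R[i].
  by rewrite /ydir !mxE eqxx.
have re0 (b : bool) : complex.Re (b%:R : R[i]) = b%:R by case: b.
have im0 (b : bool) : complex.Im (b%:R : R[i]) = 0 by case: b.
have rey (b : bool) : complex.Re ('i%C * b%:R : R[i]) = 0.
  by case: b; rewrite /= ?mulr0 ?mulr1 /=; ring.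
have imy (b : bool) : complex.Im ('i%C * b%:R : R[i]) = b%:R.
  by case: b; rewrite /= ?mulr0 ?mulr1 /=; ring.
have dE i j : dz_dzbar u i j p = ((i == j)%:R * c i)%:C.
  transitivity (
    ((hess u p (xdir i) (xdir j) + hess u p (ydir i) (ydir j)) / 4) +i*
    ((hess u p (xdir i) (ydir j) - hess u p (ydir i) (xdir j)) / 4)).
    by [].
  rewrite !hu.
  have -> : \sum_l c l * (2 * coord_dot l (xdir i) (xdir j)) =
      2 * ((i == j)%:R * c i).
    rewrite (bigD1 i)//= big1 ?addr0; last first.
      move=> l li; rewrite /coord_dot !xE !im0 !re0 (negbTE li).
      by rewrite !mul0r addr0 !mulr0.
    by rewrite /coord_dot !xE !im0 !re0 eqxx; case: (i == j) => /=; ring.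
  have -> : \sum_l c l * (2 * coord_dot l (ydir i) (ydir j)) =
      2 * ((i == j)%:R * c i).
    rewrite (bigD1 i)//= big1 ?addr0; last first.
      move=> l li; rewrite /coord_dot !yE !imy !rey (negbTE li).
      by rewrite !mul0r addr0 !mulr0.
    by rewrite /coord_dot !yE !imy !rey eqxx; case: (i == j) => /=; ring.
  have z1 : \sum_l c l * (2 * coord_dot l (xdir i) (ydir j)) = 0.
    by rewrite big1// => l _; rewrite /coord_dot xE yE im0 rey; ring.
  have z2 : \sum_l c l * (2 * coord_dot l (ydir i) (xdir j)) = 0.
    by rewrite big1// => l _; rewrite /coord_dot xE yE im0 rey; ring.
  rewrite z1 z2; apply/eqP; rewrite eq_complex /=.
  by apply/andP; split; apply/eqP; field.
rewrite /levi raddf_sum; apply: eq_bigr => i _.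
rewrite (bigD1 i)//= big1 ?addr0; last first.
  by move=> j ji; rewrite dE eq_sym (negbTE ji) mul0r !mul0r.
rewrite dE eqxx mul1r sqr_cmod /sqmod.
by case: (X 0 i) => [x y] /=; ring.
Qed.

End Hessian.

(** * Plurisubharmonicity from minorants *)

Section Plurisubharmonicity.
Context {R : realType} {n : nat}.
Local Notation Cn := 'rV[R[i]]_n.
Variables (D : set Cn) (u : Cn -> R).

Hypothesis u_usc : forall x, D x -> forall a, u x < a ->
  \forall y \near within D (nbhs x), u y < a.
Hypothesis u_minorized : forall a b l, D (a + l *: b) ->
  log_minorized l (fun w => u (a + w *: b)).

Lemma usc_on_EFin : usc_on D (fun z => (u z)%:E).
Proof.
move=> x Dx a; rewrite lte_fin => /(u_usc Dx) h.
by apply: filterS h => y; rewrite lte_fin.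
Qed.

Lemma usc_on_lne : usc_on D (fun z => lne (u z)%:E).
Proof.
have lneP (r a : R) : (lne r%:E < a%:E)%E = (r < expR a).
  rewrite /lne; case: ifPn => [r0|]; last first.
    rewrite -ltNge lte_fin => r0.
    by rewrite -[in RHS](@lnK _ r) ?posrE// ltr_expR.
  by rewrite ltNyr (le_lt_trans r0 (expR_gt0 a)).
move=> x Dx a; rewrite lneP => /(u_usc Dx) h.
by apply: filterS h => y; rewrite lneP.
Qed.

Lemma usc_on_line (f : Cn -> \bar R) (a b : Cn) : usc_on D f ->
  usc_on [set l | D (a + l *: b)] (fun l => f (a + l *: b)).
Proof. by move=> uf l Dl c /(uf _ Dl c); exact: continuous_line. Qed.

(** Restricting to complex lines turns the certificate of [log_minorized] into
    the submean inequalities for [u] and for [log u] at once. *)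
Lemma log_minorized_psh :
  plurisubharmonic D (fun z => (u z)%:E) /\
  plurisubharmonic D (fun z => lne (u z)%:E).
Proof.
have lne_fin (r : R) : (lne r%:E < +oo)%E.
  by rewrite /lne; case: ifP => _; rewrite ?ltry.
split; split.
- by move=> z _; exact: ltry.
- exact: usc_on_EFin.
- move=> a b; split; first by move=> z _; exact: ltry.
    exact: (@usc_on_line (fun z => (u z)%:E) a b usc_on_EFin).
  move=> l /u_minorized/log_minorized_submean[rho r0 h].
  by exists rho => // r /h[].
- by move=> z _; exact: lne_fin.
- exact: usc_on_lne.
- move=> a b; split; first by move=> z _; exact: lne_fin.
    exact: (@usc_on_line (fun z => lne (u z)%:E) a b usc_on_lne).
  move=> l /u_minorized/log_minorized_submean[rho r0 h].
  by exists rho => // r /h[].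
Qed.

End Plurisubharmonicity.

(** Stated within [D] because the competitor is given by different formulas on
    the two sides of a real hyperplane, and these agree only inside [D]. *)
Lemma continuous_at_usc (R : realType) (T : topologicalType) (D : set T)
    (u w : T -> R) x : {for x, continuous w} -> D x -> w x = u x ->
  (\forall y \near within D (nbhs x), u y = w y) ->
  forall a, u x < a -> \forall y \near within D (nbhs x), u y < a.
Proof.
move=> cw Dx wux nuw a; rewrite -wux => wxa.
have nw : nbhs x [set y | w y < a].
  apply: (cw [set t | t < a]); apply: open_nbhs_nbhs.
  by split; [exact: open_lt|exact: wxa].
by apply: (@filterS2 _ (nbhs x) _ _ _ _ _ nuw nw) => y h wy Dy; rewrite h.
Qed.

(** Powers with a positive exponent are also continuous at zeros of a
    nonnegative function, although [powR] itself jumps at 0 from the left. *)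
Lemma continuous_at_powR (R : realType) (T : topologicalType) (f : T -> R) x
    (q : R) : 0 < q -> (forall y, 0 <= f y) -> {for x, continuous f} ->
  {for x, continuous (fun y => f y `^ q)}.
Proof.
move=> q0 f0 cf; have := f0 x; rewrite le_eqVlt => /predU1P[fx|fx].
  rewrite /prop_for /continuous_at -fx powR0 ?gt_eqF//.
  apply/(@cvgrPdist_lt R R T (nbhs x)) => e e0.
  have h : nbhs x [set y | f y < e `^ q^-1].
    apply: (cf [set t | t < e `^ q^-1]); apply: open_nbhs_nbhs.
    by split; [exact: open_lt|rewrite /= -fx powR_gt0].
  apply: filterS h => y fy; rewrite sub0r normrN ger0_norm ?powR_ge0//.
  have -> : e = (e `^ q^-1) `^ q.
    by rewrite -powRrM mulVf ?gt_eqF// powRr1// ltW.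
  by rewrite gt0_ltr_powR ?nnegrE ?powR_ge0.
have d : derivable (fun t => t `^ q) (f x) 1.
  by apply: derivable_powR; rewrite in_itv /= andbT.
have c := differentiable_continuous ((derivable1_diffP _ _).1 d).
exact: (continuous_comp cf c).
Qed.

(** * The competitor *)

Section Competitor.
Context {R : realType} {m : nat}.
Variables (mu eps : R).
Hypotheses (m_gt0 : (0 < m)%N) (mu_gt1 : 1 < mu) (eps01 : 0 < eps < 1).
Local Notation Cn := 'rV[R[i]]_m.+1.
Implicit Types (z v p X a b : Cn).

Definition tangential z : R := \sum_(j < m) sqmod (z 0 (lift ord0 j)).

Definition shifted_sq (c : R) z : R := sqmod (z 0 ord0 + c%:C).

(** The square of the size [eps `^ mu^-1] of [z'] near the boundary at height
    [eps], with a constant that makes the second term of [inner] smaller than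
    the first one where [inner] has to be dominated by [outer]. *)
Definition bump_weight : R := eps `^ (2 / mu) / (64 * m%:R ^+ 2).

(** Chosen such that [eps ^+ 2] to this power is at least [expR (- 1)], although
    the exponent is positive. *)
Definition bump_exponent : R := (2 * (1 - ln eps))^-1.

(** The quotient is the squared modulus of a Moebius transformation of [z_1]
    that vanishes at [- eps] with a derivative of size [1 / eps] and is bounded
    on the half-plane [Re z_1 < eps]. *)
Definition inner z : R := tangential z +
  bump_weight * (shifted_sq eps z * (shifted_sq (- (2 * eps)) z)^-1).

Definition outer z : R :=
  2 * expR 1 * (tangential z * shifted_sq eps z `^ bump_exponent).

(** An upper bound, on the domain, of [outer] and, where [Re z_1 < eps], of
    [inner]. *)
Definition height : R := 8 * expR 1 * m%:R + m%:R + 1.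

Definition competitor z : R := height^-1 *
  (if complex.Re (z 0 ord0) < eps then Num.max (inner z) (outer z)
   else outer z).

Let eps_gt0 : 0 < eps. Proof. by case/andP: eps01. Qed.

Let m1 : 1 <= m%:R :> R. Proof. by rewrite ler1n. Qed.

Let ln_eps : ln eps < 0. Proof. exact: ln_lt0. Qed.

Let bump_exponent_gt0 : 0 < bump_exponent.
Proof. by rewrite invr_gt0 mulr_gt0// subr_gt0 (lt_trans ln_eps). Qed.

Let height_gt0 : 0 < height.
Proof.
by rewrite ltr_wpDl// addr_ge0 ?mulr_ge0 ?expR_ge0.
Qed.

Let weight_gt0 : 0 < bump_weight.
Proof.
by rewrite divr_gt0 ?powR_gt0// mulr_gt0// exprn_gt0// (lt_le_trans _ m1).
Qed.

Lemma tangential_ge0 z : 0 <= tangential z.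
Proof. by apply: sumr_ge0 => j _; exact: sqmod_ge0. Qed.

Lemma inner_ge0 z : 0 <= inner z.
Proof.
rewrite addr_ge0 ?tangential_ge0// mulr_ge0 ?(ltW weight_gt0)//.
by rewrite mulr_ge0 ?invr_ge0 ?sqmod_ge0.
Qed.

Lemma outer_ge0 z : 0 <= outer z.
Proof. by rewrite !mulr_ge0 ?expR_ge0 ?powR_ge0 ?tangential_ge0. Qed.

Lemma competitor_ge0 z : 0 <= competitor z.
Proof.
rewrite mulr_ge0 ?invr_ge0 ?(ltW height_gt0)//.
by case: ifP => _; rewrite ?le_max ?inner_ge0 ?outer_ge0.
Qed.

(** * Logarithmic plurisubharmonicity of the competitor *)

Let lineE a b (j : 'I_m.+1) (l : R[i]) : (a + l *: b) 0 j = b 0 j * l + a 0 j.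
Proof. by rewrite !mxE addrC mulrC. Qed.

Lemma tangential_minorized a b (l : R[i]) :
  log_minorized l (fun w => tangential (a + w *: b)).
Proof.
apply: log_minorized_sum => j; under eq_fun do rewrite lineE.
exact: log_minorized_affine.
Qed.

Let shiftedE (c : R) a b (l : R[i]) : shifted_sq c (a + l *: b) =
  sqmod (b 0 ord0 * l + (a 0 ord0 + c%:C)).
Proof. by rewrite /shifted_sq lineE addrA. Qed.

Lemma pole_neq0 z : complex.Re (z 0 ord0) < eps ->
  z 0 ord0 + (- (2 * eps))%:C != 0.
Proof.
move=> ze; apply/negP => /eqP/(congr1 (@complex.Re R)).
rewrite raddfD /= => h; have := eps_gt0; lra.
Qed.

Lemma inner_minorized a b (l : R[i]) :
  complex.Re ((a + l *: b) 0 ord0) < eps ->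
  log_minorized l (fun w => inner (a + w *: b)).
Proof.
move=> /pole_neq0; rewrite lineE -addrA => pole.
apply: log_minorizedD; first exact: tangential_minorized.
apply: log_minorizedM; first exact: log_minorized_cst (ltW weight_gt0).
apply: log_minorizedM.
  by under eq_fun do rewrite shiftedE; exact: log_minorized_affine.
by under eq_fun do rewrite shiftedE; exact: log_minorized_inv_affine.
Qed.

Lemma outer_minorized a b (l : R[i]) :
  log_minorized l (fun w => outer (a + w *: b)).
Proof.
apply: log_minorizedM.
  by apply: log_minorized_cst; rewrite mulr_ge0 ?expR_ge0.
apply: log_minorizedM; first exact: tangential_minorized.
apply: log_minorized_powR => //.
by under eq_fun do rewrite shiftedE; exact: log_minorized_affine.
Qed.

Lemma continuous_Re_first : continuous (fun z : Cn => complex.Re (z 0 ord0)).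
Proof.
move=> z.
apply: (continuous_comp (@coord_continuous R[i] 1 m.+1 0 ord0 z)).
exact: continuous_Re.
Qed.

Lemma open_left_of_eps : open [set z : Cn | complex.Re (z 0 ord0) < eps].
Proof.
exact: (open_comp (fun z _ => @continuous_Re_first z) (@open_lt R eps)).
Qed.

(** Where [Re z_1 >= eps] the competitor is a multiple of [outer], and the same
    multiple of [outer] lies below it everywhere, so the minorant of [outer]
    serves; where [Re z_1 < eps] it is locally a maximum. *)
Lemma competitor_minorized a b (l : R[i]) :
  log_minorized l (fun w => competitor (a + w *: b)).
Proof.
have h0 : 0 <= height^-1 by rewrite invr_ge0 ltW.
apply: log_minorizedM; first exact: log_minorized_cst.
have outer_le z : outer z <= (if complex.Re (z 0 ord0) < eps
    then Num.max (inner z) (outer z) else outer z).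
  by case: ifP => // _; rewrite le_max lexx orbT.
have [ze|ze] := ltP (complex.Re ((a + l *: b) 0 ord0)) eps; last first.
  apply: (log_minorized_le (outer_minorized a b l)).
  - by move=> w; apply: le_trans (outer_le _); exact: outer_ge0.
  - by rewrite ltNge ze.
  - by near=> w; exact: outer_le.
apply: (log_minorized_le (log_minorized_max (inner_minorized ze)
  (outer_minorized a b l))).
- by move=> w; apply: le_trans (outer_le _); exact: outer_ge0.
- by rewrite ze.
- have : \forall w \near l, complex.Re ((a + w *: b) 0 ord0) < eps.
    apply: (@continuous_line R m.+1 a b l
      [set z | complex.Re (z 0 ord0) < eps]).
    by apply: open_nbhs_nbhs; split; [exact: open_left_of_eps|exact: ze].
  by apply: filterS => w ->.
Unshelve. all: by end_near. Qed.

(** * Size of the competitor on the domain *)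

Lemma shifted_sqE c z : shifted_sq c z =
  (complex.Re (z 0 ord0) + c) ^+ 2 + complex.Im (z 0 ord0) ^+ 2.
Proof. by rewrite /shifted_sq /sqmod !raddfD /= addr0. Qed.

Lemma inner_le z : complex.Re (z 0 ord0) < eps ->
  inner z <= tangential z + 16 * bump_weight.
Proof.
move=> ze; rewrite lerD2l mulrC ler_pM2r ?weight_gt0//.
have d0 : 0 < shifted_sq (- (2 * eps)) z by rewrite sqmod_gt0 pole_neq0.
rewrite ler_pdivrMr// !shifted_sqE.
have y0 := sqr_ge0 (complex.Im (z 0 ord0)); have e0 := eps_gt0.
set x := complex.Re _ in ze *.
have : 0 <= (7 * eps - 5 * x) * (9 * eps - 3 * x).
  by rewrite mulr_ge0//; lra.
by move: y0; nra.
Qed.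

Lemma bump_weight_le1 : 16 * bump_weight <= 1.
Proof.
have mu0 : 0 < mu by apply: lt_trans mu_gt1.
have e1 : eps `^ (2 / mu) <= 1.
  rewrite -[leRHS](powRr0 eps); case/andP: eps01 => e0 e1.
  by apply: ger_powR; rewrite ?e0 ?(ltW e1)// divr_ge0 ?(ltW mu0).
have m0 : 0 < m%:R :> R by apply: lt_le_trans m1.
rewrite /bump_weight mulrA ler_pdivrMr ?mulr_gt0 ?exprn_gt0//.
by have := m1; nra.
Qed.

(** Where [Re z_1 >= eps / 2], one of the [m] terms [cmod z_j `^ mu] in the
    definition of the domain is at least [eps / (2 * m)]. *)
Lemma tangential_lower z : G m mu z -> eps / 2 <= complex.Re (z 0 ord0) ->
  16 * bump_weight <= tangential z.
Proof.
move=> [_ zG] ze; have mu0 : 0 < mu by apply: lt_trans mu_gt1.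
have e0 := eps_gt0; have m0 : 0 < m%:R :> R by apply: lt_le_trans m1.
pose t := eps / (2 * m%:R).
have t0 : 0 < t by rewrite divr_gt0// mulr_gt0.
have [j tj] : exists j, t <= cmod (z 0 (lift ord0 j)) `^ mu.
  apply: contrapT => /forallNP h.
  have : \sum_(j < m) cmod (z 0 (lift ord0 j)) `^ mu <= \sum_(j < m) t.
    by apply: ler_sum => j _; apply/ltW; rewrite ltNge; apply/negP/h.
  rewrite sumr_const card_ord -mulr_natl; apply/negP; rewrite -ltNge.
  apply: le_lt_trans zG; apply: le_trans ze.
  by rewrite /t le_eqVlt; apply/orP; left; apply/eqP; field; rewrite gt_eqF.
have : sqmod (z 0 (lift ord0 j)) <= tangential z.
  rewrite /tangential (bigD1 j)//= lerDl sumr_ge0// => i _; exact: sqmod_ge0.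
apply: le_trans; rewrite -sqr_cmod.
have -> : cmod (z 0 (lift ord0 j)) ^+ 2 =
    (cmod (z 0 (lift ord0 j)) `^ mu) `^ (2 / mu).
  by rewrite -powRrM mulrCA divff ?gt_eqF// mulr1 powR_mulrn ?cmod_ge0.
have q0 : 0 <= 2 / mu by rewrite divr_ge0 ?ltW.
have h := ge0_ler_powR q0 (ltW t0 : t \in Num.nneg) (powR_ge0 _ _) tj.
apply: le_trans h; rewrite /t powRM ?invr_ge0 ?mulr_ge0 ?(ltW e0) ?(ltW m0)//.
rewrite /bump_weight mulrCA ler_pM2l ?powR_gt0//.
have i0 : 0 < (2 * m%:R)^-1 :> R by rewrite invr_gt0 mulr_gt0.
have : (2 * m%:R)^-1 `^ 2%:R <= (2 * m%:R)^-1 `^ (2 / mu) :> R.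
  apply: ger_powR.
    by rewrite i0 invf_le1 ?mulr_gt0//; have := m1; lra.
  by rewrite ler_pdivrMr// ler_peMr// ltW.
apply: le_trans; rewrite powR_mulrn ?(ltW i0)//.
by rewrite le_eqVlt; apply/orP; left; apply/eqP; field; rewrite gt_eqF.
Qed.

(** [bump_exponent] tends to 0 with [eps] like [1 / ln (1 / eps)], so the power
    varies by a bounded factor only between distance [eps] and distance 1 from
    the hyperplane where it vanishes. *)
Lemma bump_ge z : 0 <= complex.Re (z 0 ord0) ->
  1 <= expR 1 * shifted_sq eps z `^ bump_exponent.
Proof.
move=> x0; have e0 := eps_gt0; have q0 := bump_exponent_gt0.
have s0 : eps ^+ 2 <= shifted_sq eps z.
  rewrite shifted_sqE; have := sqr_ge0 (complex.Im (z 0 ord0)); nra.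
have e2 : 0 < eps ^+ 2 by rewrite exprn_gt0.
have := ge0_ler_powR (ltW q0) (ltW e2 : _ \in Num.nneg) (sqmod_ge0 _) s0.
move=> h; apply: (@le_trans _ _ (expR 1 * (eps ^+ 2) `^ bump_exponent)).
  have lE : ln (eps ^+ 2) = 2 * ln eps by rewrite lnXn// mulr_natl.
  rewrite /powR gt_eqF// lE -expRD -[leLHS]expR0 ler_expR /bump_exponent.
  have l0 := ln_eps; have l1 : 0 < 1 - ln eps by lra.
  have -> : 1 + (2 * (1 - ln eps))^-1 * (2 * ln eps) = (1 - ln eps)^-1.
    by field; rewrite gt_eqF.
  by rewrite invr_ge0 ltW.
by rewrite ler_pM2l ?expR_gt0.
Qed.

(** In this strip [inner] is dominated by [outer], so that it can be dropped
    from the maximum before its pole at [z_1 = 2 * eps] is reached. *)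
Lemma inner_le_outer z : G m mu z -> eps / 2 <= complex.Re (z 0 ord0) < eps ->
  inner z <= outer z.
Proof.
move=> zG /andP[x1 x2]; apply: le_trans (inner_le x2) _.
have tl := tangential_lower zG x1.
have x0 : 0 <= complex.Re (z 0 ord0).
  by apply: le_trans x1; rewrite divr_ge0// ltW.
have := bump_ge x0; rewrite /outer; have := tangential_ge0 z.
move: (expR 1) (_ `^ _) tl => e s tl t0 es.
rewrite (_ : 2 * e * _ = 2 * tangential z * (e * s)); last by ring.
by nra.
Qed.

Lemma sqmod_lt1 z j : G m mu z -> sqmod (z 0 j) < 1.
Proof. by move=> [zD _]; rewrite -sqr_cmod exprn_ilt1 ?cmod_ge0. Qed.

Lemma tangential_le z : G m mu z -> tangential z <= m%:R.
Proof.
move=> zG; rewrite -[m in leRHS]card_ord -sumr_const.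
by apply: ler_sum => j _; exact/ltW/sqmod_lt1.
Qed.

Lemma outer_le z : G m mu z -> outer z <= 8 * expR 1 * m%:R.
Proof.
move=> zG; have tm := tangential_le zG; have t0 := tangential_ge0 z.
have s4 : shifted_sq eps z <= 4.
  have := sqmod_lt1 ord0 zG; rewrite shifted_sqE /sqmod.
  have := sqr_ge0 (complex.Im (z 0 ord0)).
  have := sqr_ge0 (complex.Re (z 0 ord0) - eps).
  have : eps ^+ 2 <= 1 by move: eps01 => /andP[]; nra.
  by rewrite sqrrB sqrrD; lra.
have p4 : shifted_sq eps z `^ bump_exponent <= 4.
  have q0 := bump_exponent_gt0.
  apply: (@le_trans _ _ (4 `^ bump_exponent)).
    by apply: ge0_ler_powR => //; rewrite ?nnegrE ?sqmod_ge0// ltW.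
  rewrite -[leRHS]powRr1//; apply: ler_powR; first by rewrite ler1n.
  by rewrite invf_le1 ?mulr_gt0//; have := ln_eps; lra.
have e0 := expR_gt0 (1 : R).
have p0 := powR_ge0 (shifted_sq eps z) bump_exponent.
rewrite /outer (_ : 8 * expR 1 * m%:R = 2 * expR 1 * (m%:R * 4)); last by ring.
by rewrite ler_pM2l ?mulr_gt0// ler_pM.
Qed.

Lemma competitor_le1 z : G m mu z -> competitor z <= 1.
Proof.
move=> zG; rewrite /competitor mulrC ler_pdivrMr// mul1r /height.
have ho := outer_le zG; have hm := m1.
case: ifP => [ze|_]; last by lra.
rewrite ge_max; apply/andP; split; last by lra.
have e0 := expR_ge0 (1 : R).
apply: le_trans (inner_le ze) _; have := tangential_le zG.
have : 0 <= 8 * expR 1 * m%:R :> R by rewrite !mulr_ge0.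
by have := bump_weight_le1; lra.
Qed.

(** * Continuity, smoothness and Levi form of the competitor *)

Lemma continuous_shifted_sq c : continuous (shifted_sq c).
Proof.
move=> z; have := @smooth_sqmod_shift R m.+1 0 setT ord0 c%:C openT.
by move=> /smooth_continuous; exact.
Qed.

Lemma tangentialE : tangential =
  (fun z => \sum_(j <- index_enum 'I_m) sqmod (z 0 (lift ord0 j) + 0)).
Proof. by apply/funext => z; apply: eq_bigr => j _; rewrite addr0. Qed.

Lemma smooth_hess_tangential (V : set Cn) p v w : open V -> V p ->
  smooth 2 V tangential /\
  hess tangential p v w = \sum_(j < m) 2 * coord_dot (lift ord0 j) v w.
Proof.
move=> oV Vp; rewrite tangentialE.
have [j|s ->] := smooth_hess_sum oV Vp (index_enum 'I_m) v w
  (u := fun j z => sqmod (z 0 (lift ord0 j) + 0)).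
  exact: smooth_sqmod_shift.
by split=> //; apply: eq_bigr => j _; rewrite hess_sqmod_shift.
Qed.

Lemma continuous_tangential : continuous tangential.
Proof.
move=> z; have [s _] := @smooth_hess_tangential setT z 0 0 openT I.
exact: (smooth_continuous s).
Qed.

Lemma continuous_inner z : complex.Re (z 0 ord0) < eps ->
  {for z, continuous inner}.
Proof.
move=> ze; have d0 : shifted_sq (- (2 * eps)) z != 0.
  by rewrite gt_eqF// sqmod_gt0 pole_neq0.
have cV := continuousV d0 (@continuous_shifted_sq (- (2 * eps)) z).
have cM := continuousM (@continuous_shifted_sq eps z) cV.
have cW := continuousM (@cst_continuous _ _ bump_weight z) cM.
exact: (continuousD (@continuous_tangential z) cW).
Qed.

Lemma continuous_outer : continuous outer.
Proof.
move=> z; have cP := continuous_at_powR bump_exponent_gt0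
  (fun y => sqmod_ge0 _ : 0 <= shifted_sq eps y) (@continuous_shifted_sq eps z).
have cM := continuousM (@continuous_tangential z) cP.
exact: (continuousM (@cst_continuous _ _ (2 * expR 1) z) cM).
Qed.

Lemma competitor_usc z : G m mu z -> forall r : R, competitor z < r ->
  \forall y \near within (G m mu) (nbhs z), competitor y < r.
Proof.
move=> zG; have [ze|ze] := ltP (complex.Re (z 0 ord0)) eps.
  have cM := continuousM (@cst_continuous _ _ height^-1 z)
    (continuous_max (continuous_inner ze) (@continuous_outer z)).
  apply: (continuous_at_usc cM zG); first by rewrite /competitor ze.
  have : nbhs z [set y : Cn | complex.Re (y 0 ord0) < eps].
    by apply: open_nbhs_nbhs; split; [exact: open_left_of_eps|].
  move=> h; apply: (@filterS _ (nbhs z) _ _ _ _ h) => y /= ye _.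
  by rewrite /competitor ye.
have cM := continuousM (@cst_continuous _ _ height^-1 z) (@continuous_outer z).
apply: (continuous_at_usc cM zG); first by rewrite /competitor ltNge ze.
have : nbhs z [set y : Cn | eps / 2 < complex.Re (y 0 ord0)].
  apply: (@continuous_Re_first z [set t | eps / 2 < t]).
  apply: open_nbhs_nbhs; split; first exact: open_gt.
  by apply: lt_le_trans ze; have := eps_gt0; lra.
move=> h; apply: (@filterS _ (nbhs z) _ _ _ _ h) => y /= /ltW y2 yG.
rewrite /competitor; case: ifP => // ye.
by rewrite (max_idPr _)// inner_le_outer// y2.
Qed.

(** Here the power in [outer] is so small that [outer] lies below the first
    term of [inner]. *)
Definition near_center : set Cn :=
  [set z : Cn | complex.Re (z 0 ord0) < eps] `&`
  [set z : Cn | shifted_sq eps z < (2 * expR 1)^-1 `^ bump_exponent^-1].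

Lemma open_near_center : open near_center.
Proof.
apply: openI; first exact: open_left_of_eps.
exact: (open_comp (fun z _ => @continuous_shifted_sq eps z) (@open_lt R _)).
Qed.

Let pt0 : pt m eps 0 ord0 = (- eps)%:C.
Proof. by rewrite /pt mxE eqxx. Qed.

Let ptj j : pt m eps 0 (lift ord0 j) = 0.
Proof. by rewrite /pt mxE. Qed.

Let pt_center : shifted_sq eps (pt m eps) = 0.
Proof. by rewrite /shifted_sq pt0 -rmorphD /= addNr /sqmod /= expr0n addr0. Qed.

Let pt_tangential : tangential (pt m eps) = 0.
Proof. by apply: big1 => j _; rewrite ptj /sqmod /= expr0n addr0. Qed.

Lemma pt_near_center : near_center (pt m eps).
Proof.
split=> /=; first by rewrite pt0 /=; have := eps_gt0; lra.
by rewrite pt_center powR_gt0// invr_gt0 mulr_gt0// expR_gt0.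
Qed.

Lemma competitor_near_center :
  {in near_center, competitor =1 (fun z => height^-1 * inner z)}.
Proof.
move=> z; rewrite inE => -[/= ze zs]; rewrite /competitor ze (max_idPl _)//.
apply: (@le_trans _ _ (tangential z)); last first.
  rewrite lerDl mulr_ge0 ?(ltW weight_gt0)//.
  by rewrite mulr_ge0 ?invr_ge0 ?sqmod_ge0.
have e0 : 0 < 2 * expR 1 :> R by rewrite mulr_gt0 ?expR_gt0.
have q0 := bump_exponent_gt0.
have : shifted_sq eps z `^ bump_exponent <= (2 * expR 1)^-1.
  have -> : (2 * expR 1)^-1 =
      ((2 * expR 1)^-1 `^ bump_exponent^-1) `^ bump_exponent :> R.
    by rewrite -powRrM mulVf ?gt_eqF// powRr1// invr_ge0 ltW.
  apply: ge0_ler_powR (ltW zs); rewrite ?nnegrE ?sqmod_ge0 ?powR_ge0//.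
  exact: ltW.
move=> h; rewrite /outer mulrCA ler_piMr ?tangential_ge0//.
by rewrite -ler_pdivlMl// mulr1.
Qed.

Lemma smooth_bump (V : set Cn) : open V ->
  (forall z, V z -> complex.Re (z 0 ord0) < eps) ->
  smooth 2 V (shifted_sq eps) /\
  smooth 2 V (fun z => (shifted_sq (- (2 * eps)) z)^-1).
Proof.
move=> oV hV; split; first exact: smooth_sqmod_shift.
apply: smoothV => //; last exact: smooth_sqmod_shift.
by move=> z Vz; rewrite gt_eqF// sqmod_gt0 pole_neq0// hV.
Qed.

(** The factor [shifted_sq eps] vanishes to second order at the centre, so only
    its own Hessian survives, multiplied by the value [1 / (9 * eps ^+ 2)] of
    the other factor. *)
Lemma smooth_hess_competitor v w :
  smooth 2 near_center (fun z => height^-1 * inner z) /\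
  hess competitor (pt m eps) v w = height^-1 *
    (\sum_(j < m) 2 * coord_dot (lift ord0 j) v w +
     bump_weight / (9 * eps ^+ 2) * (2 * coord_dot ord0 v w)).
Proof.
have oV := open_near_center; have Vp := pt_near_center.
rewrite (eq_in_hess oV Vp v w competitor_near_center).
have [st ht] := smooth_hess_tangential v w oV Vp.
have [sN sQ] : _ /\ _ := smooth_bump oV (fun z h => h.1).
have sM := smoothM oV sN sQ.
have sW := smoothM oV (smooth_cst 2 near_center bump_weight) sM.
have sI := smoothD oV st sW.
split; first exact: (smoothM oV (smooth_cst 2 near_center height^-1) sI).
rewrite (hess_scale oV Vp height^-1 v w sI).
rewrite (hessD oV Vp v w st sW) ht (hess_scale oV Vp bump_weight v w sM).
rewrite (hessM oV Vp v w sN sQ).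
have p0 : pt m eps 0 ord0 + eps%:C = 0 by rewrite pt0 -rmorphD /= addNr.
have r0 v' : rderiv v' (shifted_sq eps) (pt m eps) = 0.
  exact: rderiv_sqmod_shift0.
have -> : hess (shifted_sq eps) (pt m eps) v w = 2 * coord_dot ord0 v w.
  exact: hess_sqmod_shift.
rewrite !r0 pt_center.
have -> : shifted_sq (- (2 * eps)) (pt m eps) = 9 * eps ^+ 2.
  by rewrite shifted_sqE pt0 /=; ring.
by congr (_ * (_ + _)); field; rewrite gt_eqF.
Qed.

Lemma levi_competitor X : levi competitor (pt m eps) X = height^-1 *
  (\sum_(j < m) cmod (X 0 (lift ord0 j)) ^+ 2 +
   bump_weight / (9 * eps ^+ 2) * cmod (X 0 ord0) ^+ 2).
Proof.
pose c (l : 'I_m.+1) : R :=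
  height^-1 * (if l == ord0 then bump_weight / (9 * eps ^+ 2) else 1).
have hc v w : hess competitor (pt m eps) v w =
    \sum_l c l * (2 * coord_dot l v w).
  have [_ ->] := smooth_hess_competitor v w.
  rewrite big_ord_recl /c eqxx mulrDr [LHS]addrC mulr_sumr.
  congr (_ + _); first exact: mulrA.
  by apply: eq_bigr => j _; rewrite mulr1.
rewrite (levi_diag X hc) big_ord_recl /c eqxx mulrDr [RHS]addrC mulr_sumr.
congr (_ + _); first exact/esym/mulrA.
by apply: eq_bigr => j _; rewrite mulr1.
Qed.

Lemma competitor_sibony_class :
  sibony_class (pt m eps) (G m mu) competitor.
Proof.
have [psh lpsh] := log_minorized_psh competitor_usc
  (fun a b l _ => competitor_minorized a b l).
split=> //.
- rewrite competitor_near_center ?inE; last exact: pt_near_center.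
  by rewrite /inner pt_tangential pt_center mul0r mulr0 addr0 mulr0.
- exists near_center; split; [exact: open_near_center|exact: pt_near_center|].
  apply: smooth_C2; have [s _] := smooth_hess_competitor 0 0.
  apply: (eq_smooth open_near_center _ s) => z zV.
  by rewrite competitor_near_center.
- by move=> z zG; rewrite competitor_ge0 competitor_le1.
Qed.

End Competitor.

(** * The lower bound *)

Theorem proposition11 (R : realType) (m : nat) (hn : (2 <= m.+1)%N)
    (mu : R) (mu_gt1 : 1 < mu) (mu_le2 : mu <= 2) :
  exists2 c : R, 0 < c &
    forall eps : R, 0 < eps < 1 -> forall X : 'rV[R[i]]_m.+1,
      ((c * (eps `^ (mu^-1 - 1) * cmod (X 0 ord0) + enorm X))%:E
        <= sibony_metric (G m mu) (pt m eps) X)%E.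
Proof.
have m_gt0 : (0 < m)%N by [].
have m1 : 1 <= m%:R :> R by rewrite ler1n.
pose h : R := @height R m.
have h0 : 0 < h by rewrite ltr_wpDl// addr_ge0 ?mulr_ge0 ?expR_ge0.
have m0 : 0 < m%:R :> R by apply: lt_le_trans m1.
(* The Levi form of the competitor is the square of the required bound up to
   the factors [h] and [(24 * m) ^+ 2]; the extra factor 4 pays for expanding
   the square of the sum. *)
pose k : R := (48 * m%:R) ^+ 2 * h.
have k0 : 0 < k by rewrite mulr_gt0// exprn_gt0// mulr_gt0.
exists (Num.sqrt k^-1); first by rewrite sqrtr_gt0 invr_gt0.
move=> eps eps01 X.
apply: (@le_trans _ _
  (Num.sqrt (levi (@competitor R m mu eps) (pt m eps) X))%:E); last first.
  apply: ereal_sup_ubound; exists (competitor mu eps) => //.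
  exact: competitor_sibony_class.
rewrite lee_fin levi_competitor// -/h.
have e0 : 0 < eps by case/andP: eps01.
set T := eps `^ _.
have T1 : 1 <= T.
  rewrite /T -[leLHS](powRr0 eps); apply: ger_powR.
    by case/andP: eps01 => -> /ltW.
  by rewrite subr_le0 invf_le1 ?ltW// (lt_trans _ mu_gt1).
have TE : @bump_weight R m mu eps / (9 * eps ^+ 2) = T ^+ 2 / (24 * m%:R) ^+ 2.
  have -> : T ^+ 2 = eps `^ (2 / mu) / eps ^+ 2.
    have -> : 2 / mu = mu^-1 + mu^-1 by rewrite mulrC mulr_natr mulr2n.
    have en0 : eps != 0 by rewrite gt_eqF.
    have -> : T = eps `^ mu^-1 / eps.
      by rewrite /T powRB ?en0 ?implybT// powRr1// ltW.
    by rewrite powRD ?en0 ?implybT// expr_div_n -expr2.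
  rewrite /bump_weight; field.
  by rewrite !gt_eqF// (lt_le_trans _ m1).
set S := \sum_(j < m) cmod (X 0 (lift ord0 j)) ^+ 2.
have S0 : 0 <= S by apply: sumr_ge0 => j _; exact: sqr_ge0.
set x := cmod (X 0 ord0); have x0 : 0 <= x by exact: cmod_ge0.
have E2 : enorm X ^+ 2 = x ^+ 2 + S.
  by rewrite /enorm big_ord_recl sqr_sqrtr// addr_ge0// sqr_ge0.
have E0 : 0 <= enorm X by exact: sqrtr_ge0.
move: (enorm X) E0 E2 => E E0 E2.
have l0 : 0 <= T * x + E by rewrite addr_ge0 ?mulr_ge0// (le_trans _ T1).
rewrite -[X in _ * X](ger0_norm l0) -sqrtr_sqr -sqrtrM ?invr_ge0 ?(ltW k0)//.
rewrite ler_sqrt; last first.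
  rewrite mulr_ge0 ?invr_ge0 ?(ltW h0)// addr_ge0// TE mulr_ge0 ?sqr_ge0//.
  by rewrite divr_ge0 ?sqr_ge0.
have bound : (T * x + E) ^+ 2 <= 4 * (T * x) ^+ 2 + 2 * S.
  have xT : x ^+ 2 <= (T * x) ^+ 2.
    by rewrite lerXn2r ?nnegrE ?mulr_ge0// ?ler_peMl// (le_trans _ T1).
  by have := sqr_ge0 (T * x - E); rewrite sqrrB sqrrD E2; lra.
rewrite TE ler_pdivrMl// /k.
have -> : (48 * m%:R) ^+ 2 * h *
    (h^-1 * (S + T ^+ 2 / (24 * m%:R) ^+ 2 * x ^+ 2)) =
    (48 * m%:R) ^+ 2 * S + 4 * (T * x) ^+ 2.
  by field; rewrite !gt_eqF.
apply: le_trans bound _; rewrite addrC lerD2r ler_wpM2r//.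
by have := m1; nra.
Qed.
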